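(* Let $G$ be a finite subgroup of $SU(2)$, acting on $S^4$ through left multiplication by unit quaternions on $\mathbb{H}$ (see context). Then for every $\alpha\in H^3(BG;U(1))$ the twisted quasi-elliptic cohomology of $S^4$ is isomorphic to the untwisted theory: $$QEll^{\alpha+\ast}_G(S^4)\;\cong\; QEll^{\ast}_G(S^4).$$
   Context: Action on $S^4$: identify $SU(2)\cong Spin(3)$ with the group of unit quaternions and $S^4$ with the unit sphere of $\mathbb{H}\oplus\mathbb{R}\cong\mathbb{R}^5$. A unit quaternion $g\in G$ acts by $g\cdot(y,s)=(gy,s)$. (This is the composite of $G\hookrightarrow Spin(3)$, the inclusion of $Spin(3)$ as the first factor of $Spin(4)=Spin(3)\times Spin(3)$, and $Spin(4)\hookrightarrow Spin(5)$, where $(q,r)\in Spin(4)$ acts on $\mathbb{H}=\mathbb{R}^4$ by $y\mapsto qy\bar r$.) Notation: $\mathbb{T}=\mathbb{R}/\mathbb{Z}\cong U(1)$. For a finite group $G$ and $g\in G$, $C_G(g)$ is the centralizer and $\Lambda_G(g):=(C_G(g)\times\mathbb{R})/\langle(g,-1)\rangle$. For a $G$-space $X$, $\Lambda_G(g)$ acts on the fixed-point space $X^g$ by $[h,t]\cdot x=h\cdot x$. Quasi-elliptic cohomology is $QEll^*_G(X):=\prod_{g}K^*_{\Lambda_G(g)}(X^g)$, with $g$ running over representatives of the conjugacy classes of $G$. Twisted version: represent $\alpha\in H^3(BG;U(1))$ by a normalised 3-cocycle. For each $g$, $\alpha$ transgresses to a normalised 2-cocycle $\theta_g$ on $C_G(g)$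 with values in $\mathbb{T}$, representing the component in $H^2(BC_G(g);U(1))$ of $\pi_*e^*\alpha\in H^2(\mathrm{Map}(B\mathbb{Z},BG);U(1))\cong\bigoplus_{[g]}H^2(BC_G(g);U(1))$, where $e:B\mathbb{Z}\times\mathrm{Map}(B\mathbb{Z},BG)\to BG$ is evaluation and $\pi$ is the projection to $\mathrm{Map}(B\mathbb{Z},BG)$; explicitly (multiplicatively) $\theta_g(h,k)=\alpha(h,k,g)\alpha(g,h,k)/\alpha(h,g,k)$. Let $C_G^\alpha(g)$ be the set $\mathbb{T}\times C_G(g)$ with product $(a,h)(b,k)=(a+b+\theta_g(h,k),hk)$, and $\Lambda_G^\alpha(g):=(\mathbb{R}\times C_G^\alpha(g))/\langle(-1,(0,g))\rangle$, a central extension of $\Lambda_G(g)$ by $\mathbb{T}$. $K^{\theta_g+*}_{\Lambda_G(g)}(X^g)$ denotes the corresponding twisted equivariant K-theory: the Grothendieck group of $\Lambda^\alpha_G(g)$-equivariant complex vector bundles on $X^g$ on which the central circle $\mathbb{T}$ acts on fibres by scalar multiplication (extended to all degrees in the usual way). Then $QEll^{\alpha+*}_G(X):=\prod_{g}K^{\theta_g+*}_{\Lambda_G(g)}(X^g)$, with $g$ running over representatives of the conjugacy classes of $G$. *)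

(* Defs.v *)
From HB Require Import structures.
From mathcomp Require Import all_boot all_order all_algebra all_fingroup finmap.
From mathcomp Require Import ring_quotient generic_quotient ring.
From mathcomp Require Import all_classical reals topology normedtype.
From mathcomp Require Import complex freeg.
Import numFieldNormedType.Exports.
Import Order.TTheory GRing.Theory Num.Theory.

Set Implicit Arguments.
Unset Strict Implicit.
Unset Printing Implicit Defensive.

Local Open Scope classical_set_scope.
Local Open Scope quotient_scope.
Local Open Scope ring_scope.

(* Continuity of the group law is not part of the structure; the instances
   below are all topological groups. *)
#[short(type="tgroupType")]
HB.structure Definition TGroup := {T of Topological T & monoid.Group T}.

HB.instance Definition _ (P Q : tgroupType) := Group.on (P * Q)%type.

(* The additive group of R, written multiplicatively. *)
Definition Rgrp (R : realType) : Type := R.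
HB.instance Definition _ (R : realType) := Topological.copy (Rgrp R) R.

Section RgrpGroup.
Context (R : realType).
Let mul (x y : Rgrp R) : Rgrp R := (x : R) + y.
Let inv (x : Rgrp R) : Rgrp R := - (x : R).
Let one : Rgrp R := (0 : R).
Let mulA : associative mul. Proof. exact: addrA. Qed.
Let mul1 : left_id one mul. Proof. exact: add0r. Qed.
Let mulr1 : right_id one mul. Proof. exact: addr0. Qed.
Let mulV : left_inverse one inv mul. Proof. exact: addNr. Qed.
Let mulrV : right_inverse one inv mul. Proof. exact: addrN. Qed.
HB.instance Definition _ := isGroup.Build (Rgrp R) mulA mul1 mulr1 mulV mulrV.
End RgrpGroup.

(* The alias makes the topology of R[i] available. *)
Definition CC (R : realType) : numClosedFieldType := R[i].

Record U1 (R : realType) := MkU1 { u1val :> CC R ; u1P : `|u1val| == 1 }.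
HB.instance Definition _ (R : realType) := [isSub for @u1val R].
HB.instance Definition _ (R : realType) := [Choice of U1 R by <:].
HB.instance Definition _ (R : realType) :=
  Topological.copy (U1 R) (initial_topology (@u1val R)).

Section U1Group.
Context (R : realType).
Implicit Types x y z : U1 R.

Lemma u1_neq0 x : u1val x != 0.
Proof. by rewrite -normr_eq0 (eqP (u1P x)) oner_neq0. Qed.

Fact u1_one_subproof : `|1 : CC R| == 1. Proof. by rewrite normr1. Qed.
Fact u1_mul_subproof x y : `|u1val x * u1val y| == 1.
Proof. by rewrite normrM (eqP (u1P x)) (eqP (u1P y)) mulr1. Qed.
Fact u1_inv_subproof x : `|(u1val x)^-1| == 1.
Proof. by rewrite normfV (eqP (u1P x)) invr1. Qed.

Let one := MkU1 u1_one_subproof.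
Let mul x y := MkU1 (u1_mul_subproof x y).
Let inv x := MkU1 (u1_inv_subproof x).
Let mulA : associative mul.
Proof. by move=> x y z; apply: val_inj; exact: mulrA. Qed.
Let mul1 : left_id one mul.
Proof. by move=> x; apply: val_inj; exact: mul1r. Qed.
Let mulr1 : right_id one mul.
Proof. by move=> x; apply: val_inj; exact: mulr1. Qed.
Let mulV : left_inverse one inv mul.
Proof. by move=> x; apply: val_inj; exact: mulVf (u1_neq0 x). Qed.
Let mulrV : right_inverse one inv mul.
Proof. by move=> x; apply: val_inj; exact: mulfV (u1_neq0 x). Qed.
HB.instance Definition _ := isGroup.Build (U1 R) mulA mul1 mulr1 mulV mulrV.

Lemma u1M x y : u1val (x * y)%g = u1val x * u1val y. Proof. by []. Qed.
Lemma u1V x : u1val (x^-1)%g = (u1val x)^-1. Proof. by []. Qed.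
Lemma u11 : u1val (1%g : U1 R) = 1. Proof. by []. Qed.
Lemma u1_mulC x y : (x * y = y * x)%g.
Proof. by apply: val_inj; rewrite /= mulrC. Qed.
End U1Group.

Definition disc (gT : finGroupType) : Type := gT.
HB.instance Definition _ (gT : finGroupType) := FinGroup.copy (disc gT) gT.
HB.instance Definition _ (gT : finGroupType) :=
  Topological.copy (disc gT) (discrete_topology gT).

Record central (P : groupType) := Central {
  celt : P ;
  centralP : forall x : P, (celt * x = x * celt)%g
}.

Definition in_cycle (P : groupType) (z x : P) : Prop :=
  exists n : nat, x = (z ^+ n)%g \/ x = (z ^- n)%g.

Section CentralQuotient.
Context (P : tgroupType) (c : central P).
Local Notation z := (celt c).
Local Open Scope group_scope.

Definition crel (x y : P) : bool := `[< in_cycle z (x^-1 * y) >].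

Lemma in_cycle1 : in_cycle z 1. Proof. by exists 0%N; left. Qed.
Lemma in_cycleV x : in_cycle z x -> in_cycle z x^-1.
Proof.
case=> n [->|->]; exists n; [by right | by left; rewrite invgK].
Qed.

Let comm_zX n x : z ^+ n * x = x * z ^+ n.
Proof.
elim: n => [|n IH]; first by rewrite expg0 mul1g mulg1.
by rewrite expgS -mulgA IH mulgA centralP -mulgA.
Qed.

Lemma in_cycleC x y : in_cycle z x -> x * y = y * x.
Proof.
case=> n [->|->]; first exact: comm_zX.
apply: (mulgI (z ^+ n)); rewrite mulgA mulgV mul1g mulgA comm_zX.
by rewrite -mulgA mulgV mulg1.
Qed.

Lemma in_cycleMz x : in_cycle z x -> in_cycle z (z * x).
Proof.
case=> n [->|->]; first by exists n.+1; left; rewrite expgS.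
case: n => [|n]; first by exists 1%N; left; rewrite expg0 invg1 mulg1 expg1.
by exists n; right; rewrite expgSr invMg mulgA mulgV mul1g.
Qed.

Lemma in_cycleMzV x : in_cycle z x -> in_cycle z (z^-1 * x).
Proof.
move=> hx; rewrite -[_ * x]invgK; apply: in_cycleV.
rewrite invMg invgK; have hV := in_cycleV hx.
by rewrite (in_cycleC _ hV); apply: in_cycleMz.
Qed.

Lemma in_cycleM x y : in_cycle z x -> in_cycle z y -> in_cycle z (x * y).
Proof.
move=> [n [->|->]] hy.
  elim: n => [|n IH]; first by rewrite expg0 mul1g.
  by rewrite expgS -mulgA; apply: in_cycleMz.
elim: n => [|n IH]; first by rewrite expg0 invg1 mul1g.
by rewrite expgSr invMg -mulgA; apply: in_cycleMzV.
Qed.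

Lemma crel_equiv : equiv_class_of crel.
Proof.
split=> [x|x y|y x w]; rewrite /crel.
- by apply/asboolP; rewrite mulVg; exact: in_cycle1.
- by apply: asbool_equiv_eq; split=> /in_cycleV; rewrite invMg invgK.
- move=> /asboolP h1 /asboolP h2; apply/asboolP.
  have -> : x^-1 * w = (x^-1 * y) * (y^-1 * w) by rewrite mulgA mulgK.
  exact: in_cycleM.
Qed.
Canonical crel_equivRel := EquivRelPack crel_equiv.

Definition cquot : Type := quotient_topology {eq_quot crel_equivRel}.
HB.instance Definition _ :=
  Topological.copy cquot (quotient_topology {eq_quot crel_equivRel}).

Definition cproj (x : P) : cquot := (\pi_{eq_quot crel_equivRel} x)%qT.
Definition crepr (q : cquot) : P := repr (q : {eq_quot crel_equivRel}).

Lemma creprK q : cproj (crepr q) = q. Proof. exact: reprK. Qed.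

Lemma cprojP x y : cproj x = cproj y <-> in_cycle z (x^-1 * y).
Proof.
by split=> [/eqmodP/asboolP|h]; [|apply/eqmodP/asboolP].
Qed.

Lemma crepr_cproj x : in_cycle z (x^-1 * crepr (cproj x)).
Proof. by apply/cprojP; rewrite creprK. Qed.

Lemma cproj_continuous : continuous cproj.
Proof. exact: (@pi_continuous _ {eq_quot crel_equivRel}). Qed.

Definition cquot_one := cproj 1.
Definition cquot_mul (p q : cquot) := cproj (crepr p * crepr q).
Definition cquot_inv (p : cquot) := cproj (crepr p)^-1.

Lemma cquot_mulE x y : cquot_mul (cproj x) (cproj y) = cproj (x * y).
Proof.
apply/esym/cprojP.
have hx := crepr_cproj x; have hy := crepr_cproj y.
rewrite invMg.
have -> : y^-1 * x^-1 * (crepr (cproj x) * crepr (cproj y))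
   = (x^-1 * crepr (cproj x)) * (y^-1 * crepr (cproj y)).
  by rewrite [RHS]mulgA (in_cycleC _ hx) -!mulgA.
exact: in_cycleM.
Qed.

Lemma cquot_invE x : cquot_inv (cproj x) = cproj x^-1.
Proof.
apply/cprojP; rewrite invgK.
have h := crepr_cproj x.
have hx : crepr (cproj x) = x^-1 * crepr (cproj x) * x.
  by rewrite (in_cycleC x h) mulgA mulgV mul1g.
by rewrite hx mulgK.
Qed.

Let mulA : associative cquot_mul.
Proof.
move=> p q r; rewrite -(creprK p) -(creprK q) -(creprK r).
by rewrite !cquot_mulE mulgA.
Qed.
Let mul1 : left_id cquot_one cquot_mul.
Proof. by move=> p; rewrite -(creprK p) cquot_mulE mul1g. Qed.
Let mulr1 : right_id cquot_one cquot_mul.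
Proof. by move=> p; rewrite -(creprK p) cquot_mulE mulg1. Qed.
Let mulV : left_inverse cquot_one cquot_inv cquot_mul.
Proof. by move=> p; rewrite -(creprK p) cquot_invE cquot_mulE mulVg. Qed.
Let mulrV : right_inverse cquot_one cquot_inv cquot_mul.
Proof. by move=> p; rewrite -(creprK p) cquot_invE cquot_mulE mulgV. Qed.
HB.instance Definition _ := isGroup.Build cquot mulA mul1 mulr1 mulV mulrV.

Lemma cprojM x y : cproj (x * y) = cproj x * cproj y.
Proof. by rewrite -cquot_mulE. Qed.
Lemma cproj1 : cproj 1 = 1. Proof. by []. Qed.
End CentralQuotient.

Record cocycle2 (R : realType) (H : groupType) := Cocycle2 {
  coc2 :> H -> H -> U1 R ;
  coc2_1l : forall h, coc2 1%g h = 1%g ;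
  coc2_1r : forall h, coc2 h 1%g = 1%g ;
  coc2P : forall h k l,
    (coc2 h k * coc2 (h * k) l = coc2 k l * coc2 h (k * l))%g
}.

Definition cext (R : realType) (H : tgroupType) (theta : cocycle2 R H) : Type :=
  (U1 R * H)%type.

Section CentralExtension.
Context (R : realType) (H : tgroupType) (theta : cocycle2 R H).
Local Open Scope group_scope.

HB.instance Definition _ :=
  Topological.copy (cext theta) (U1 R * H)%type.

Definition cext_mul (p q : cext theta) : cext theta :=
  (p.1 * q.1 * theta p.2 q.2, p.2 * q.2).
Definition cext_inv (p : cext theta) : cext theta :=
  (p.1^-1 * (theta p.2 p.2^-1)^-1, p.2^-1).
Definition cext_one : cext theta := (1, 1).

Let mulA : associative cext_mul.
Proof.
move=> [a h] [b k] [c l]; rewrite /cext_mul /=; congr (_, _); last exact: mulgA.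
have := congr1 (@u1val R) (coc2P theta h k l); rewrite !u1M => e.
apply: val_inj => /=.
transitivity (u1val a * u1val b * u1val c * (u1val (theta k l) * u1val (theta h (k * l)%g)))%R.
  by ring.
by rewrite -e; ring.
Qed.
Let mul1 : left_id cext_one cext_mul.
Proof. by move=> [a h]; rewrite /cext_mul /= coc2_1l !mul1g mulg1. Qed.
Let mulr1 : right_id cext_one cext_mul.
Proof. by move=> [a h]; rewrite /cext_mul /= coc2_1r !mulg1. Qed.
Let mulV : left_inverse cext_one cext_inv cext_mul.
Proof.
move=> [a h]; rewrite /cext_mul /cext_inv /= mulVg; congr (_, _).
have := coc2P theta h h^-1 h; rewrite mulVg mulgV coc2_1l coc2_1r !mulg1 => <-.
by rewrite (u1_mulC a^-1) mulgVK mulVg.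
Qed.
Let mulrV : right_inverse cext_one cext_inv cext_mul.
Proof.
move=> [a h]; rewrite /cext_mul /cext_inv /= mulgV; congr (_, _).
by rewrite mulgA mulgV mul1g mulVg.
Qed.
HB.instance Definition _ := isGroup.Build (cext theta) mulA mul1 mulr1 mulV mulrV.

End CentralExtension.

(* The classes of these cocycles are the elements of H^3(BG; U(1)). *)
Record cocycle3 (R : realType) (gT : finGroupType) := Cocycle3 {
  coc3 :> gT -> gT -> gT -> U1 R ;
  coc3_1l : forall h k, coc3 1%g h k = 1%g ;
  coc3_1m : forall h k, coc3 h 1%g k = 1%g ;
  coc3_1r : forall h k, coc3 h k 1%g = 1%g ;
  coc3P : forall g h k l,
    (coc3 h k l * coc3 g (h * k) l * coc3 g h k
       = coc3 (g * h) k l * coc3 g h (k * l))%g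
}.

Definition cent (gT : finGroupType) (g : gT) : tgroupType :=
  disc (subg_of 'C[g]%G).

Definition cent_val (gT : finGroupType) (g : gT) (h : cent g) : gT :=
  sgval (h : subg_of 'C[g]%G).

Definition cent_self (gT : finGroupType) (g : gT) : cent g := subg 'C[g]%G g.

Section Cent.
Context (gT : finGroupType) (g : gT).
Local Open Scope group_scope.

Lemma cent_valM (h k : cent g) : cent_val (h * k) = cent_val h * cent_val k.
Proof. by []. Qed.
Lemma cent_val1 : cent_val (1 : cent g) = 1.
Proof. by []. Qed.
Lemma cent_valC (h : cent g) : g * cent_val h = cent_val h * g.
Proof. by have /cent1P := subgP (h : subg_of 'C[g]%G); exact. Qed.
Lemma cent_selfE : cent_val (cent_self g) = g.
Proof. by rewrite /cent_val subgK // cent1id. Qed.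
Lemma cent_val_inj : injective (@cent_val gT g).
Proof. exact: val_inj. Qed.
Lemma cent_selfC (h : cent g) : cent_self g * h = h * cent_self g.
Proof. by apply: cent_val_inj; rewrite !cent_valM cent_selfE cent_valC. Qed.
End Cent.

Lemma transgr_field (F : fieldType)
    (a1 a2 a3 a4 b1 c1 c2 c3 d1 e1 e2 e3 e4 f1 f2 f3 : F) :
  a1 != 0 -> b1 != 0 -> c2 != 0 -> c3 != 0 -> d1 != 0 -> e1 != 0 ->
  e3 != 0 -> e4 != 0 ->
  a1 * a2 * a3 = b1 * a4 -> c1 * d1 * c2 = b1 * c3 ->
  e1 * d1 * e2 = e3 * e4 -> f1 * f2 * a1 = f3 * e4 ->
  e2 * a3 * c2^-1 * (f3 * a2 * e3^-1) = f1 * c1 * e1^-1 * (f2 * a4 * c3^-1).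
Proof.
move=> a10 b10 c20 c30 d10 e10 e30 e40 h1 h2 h3 h4.
have k0 : a1 * b1 * d1 * e4 != 0 by rewrite !mulf_neq0.
have -> : e2 * a3 * c2^-1 * (f3 * a2 * e3^-1)
    = (e2 * a3 * f3 * a2 * e1 * c3) / (c2 * e3 * e1 * c3).
  by field; rewrite c20 e30 e10 c30.
have -> : f1 * c1 * e1^-1 * (f2 * a4 * c3^-1)
    = (f1 * c1 * f2 * a4 * c2 * e3) / (c2 * e3 * e1 * c3).
  by field; rewrite c20 e30 e10 c30.
congr (_ / _); apply: (mulIf k0).
transitivity ((a1 * a2 * a3) * (b1 * c3) * (e1 * d1 * e2) * (f3 * e4)).
  by ring.
by rewrite h1 -h2 h3 -h4; ring.
Qed.

Section Transgression.
Context (R : realType) (gT : finGroupType) (alpha : cocycle3 R gT) (g : gT).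
Local Open Scope group_scope.

Definition transgr (h k : cent g) : U1 R :=
  alpha (cent_val h) (cent_val k) g * alpha g (cent_val h) (cent_val k)
    * (alpha (cent_val h) g (cent_val k))^-1.

Let transgr_1l h : transgr 1 h = 1.
Proof.
by rewrite /transgr cent_val1 !coc3_1l coc3_1m mulg1 mulgV.
Qed.
Let transgr_1r h : transgr h 1 = 1.
Proof.
by rewrite /transgr cent_val1 coc3_1m !coc3_1r mulg1 mulgV.
Qed.
Let transgrP h k l :
  transgr h k * transgr (h * k) l = transgr k l * transgr h (k * l).
Proof.
rewrite /transgr !cent_valM.
move: (cent_valC h) (cent_valC k) (cent_valC l).
set x := cent_val h; set y := cent_val k; set w := cent_val l => cx cy cw.
have e1 := congr1 (@u1val R) (coc3P alpha g x y w).
have e2 := congr1 (@u1val R) (coc3P alpha x g y w).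
have e3 := congr1 (@u1val R) (coc3P alpha x y g w).
have e4 := congr1 (@u1val R) (coc3P alpha x y w g).
rewrite !u1M cx in e1; rewrite !u1M cy in e2; rewrite !u1M cw in e3.
rewrite !u1M in e4.
have n a b c := u1_neq0 (alpha a b c).
apply: val_inj => /=; move: e1 e2 e3 e4.
by apply: transgr_field; exact: n.
Qed.

Definition transgression : cocycle2 R (cent g) :=
  Cocycle2 transgr_1l transgr_1r transgrP.
End Transgression.

Section Continuity.
Context {A B D : topologicalType}.

Lemma continuous_pair (f : A -> B) (g : A -> D) :
  continuous f -> continuous g -> continuous (fun a => (f a, g a)).
Proof. by move=> cf cg a; apply: cvg_pair; [exact: cf | exact: cg]. Qed.

Lemma continuous_compose (f : A -> B) (g : B -> D) :
  continuous f -> continuous g -> continuous (fun a => g (f a)).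
Proof. by move=> cf cg a; apply: continuous_comp; [exact: cf | exact: cg]. Qed.

Lemma continuous_fst : continuous (fst : A * B -> A).
Proof. by move=> a; exact: cvg_fst. Qed.

Lemma continuous_snd : continuous (snd : A * B -> B).
Proof. by move=> a; exact: cvg_snd. Qed.

Lemma continuous_to_initial (E : choiceType) (g : E -> B) (f : A -> E) :
  continuous (g \o f) -> continuous (f : A -> initial_topology g).
Proof.
by move=> cf; apply/continuousP => _ [V oV <-]; exact: (continuousP _).1 cf V oV.
Qed.
End Continuity.

Lemma continuous_disc (gT : finGroupType) (A B : topologicalType)
    (f : disc gT * A -> B) :
  (forall g, continuous (fun a => f (g, a))) -> continuous f.
Proof.
move=> cf [g0 a0].
apply: (cvg_trans (near_eq_cvg (f := fun ga => f (g0, ga.2)) _)).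
  exists ([set g0], setT) => /=.
    by split; [exact: (@discrete_set1 (discrete_topology _)) | exact: filterT].
  by move=> [g a] [/= -> _].
have h := continuous_compose (@continuous_snd (disc gT) A) (cf g0) (x:= (g0, a0)).
exact h.
Qed.

Record gspace (P : tgroupType) := GSpace {
  gsp :> topologicalType ;
  gact : P -> gsp -> gsp ;
  gact1 : forall x, gact 1%g x = x ;
  gactM : forall p q x, gact (p * q)%g x = gact p (gact q x) ;
  gact_cont : continuous (fun px : P * gsp => gact px.1 px.2)
}.

Section ProductSpace.
Context (P : tgroupType) (Y : gspace P) (S : topologicalType).
Definition prod_act (p : P) (ys : Y * S) : (Y * S)%type := (gact p ys.1, ys.2).
Let act1 ys : prod_act 1%g ys = ys.
Proof. by case: ys => y s; rewrite /prod_act gact1. Qed.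
Let actM p q ys : prod_act (p * q)%g ys = prod_act p (prod_act q ys).
Proof. by rewrite /prod_act gactM. Qed.
Let act_cont : continuous (fun px : P * (Y * S) => prod_act px.1 px.2).
Proof.
apply: continuous_pair; last first.
  exact: (continuous_compose (@continuous_snd _ _) (@continuous_snd _ _)).
apply: (continuous_compose (f := fun px : P * (Y * S) => (px.1, px.2.1))
  (g := fun px : P * Y => gact px.1 px.2)); last exact: gact_cont.
apply: continuous_pair; first exact: continuous_fst.
exact: (continuous_compose (@continuous_snd _ _) (@continuous_fst _ _)).
Qed.
Definition prod_gspace : gspace P := GSpace act1 actM act_cont.
End ProductSpace.

(* A group over the centraliser of g with a central lift of g.  The two
   instances of interest are the centraliser itself and its central extension
   by the transgressed cocycle. *)
Record over_cent (gT : finGroupType) (g : gT) := OverCent {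
  oc_grp :> tgroupType ;
  oc_pr : oc_grp -> cent g ;
  oc_prM : {morph oc_pr : x y / (x * y)%g} ;
  oc_pr_cont : continuous oc_pr ;
  oc_lift : central oc_grp ;
  oc_liftP : oc_pr (celt oc_lift) = cent_self g
}.

Section Lambda.
Context (R : realType) (gT : finGroupType) (g : gT) (T : over_cent g).

Definition lam_gen : (Rgrp R * T)%type := ((-1 : R), celt (oc_lift T)).

Lemma lam_gen_central x : (lam_gen * x = x * lam_gen)%g.
Proof.
case: x => t x; congr (_, _); last exact: centralP.
exact: addrC.
Qed.

(* (R x T) / <(-1, lift of g)>: Lambda_G(g) for T = C_G(g), and
   Lambda^alpha_G(g) for T = C^alpha_G(g) *)
Definition Lambda : tgroupType := cquot (Central lam_gen_central).

Definition lam_pr (q : Lambda) : gT := cent_val (oc_pr (crepr q).2).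
End Lambda.

Section FixedPoints.
Context (R : realType) (gT : finGroupType) (g : gT) (T : over_cent g)
  (X : gspace (disc gT)).
Local Notation Lam := (Lambda R T).

Definition fixpts : set X := [set x | gact (g : disc gT) x = x].

Lemma fixptsX n x : fixpts x -> gact ((g ^+ n)%g : disc gT) x = x.
Proof.
move=> gx; elim: n => [|n IH]; first by rewrite expg0 gact1.
by rewrite expgS (@gactM (disc gT)) IH.
Qed.

Lemma fixptsV n x : fixpts x -> gact ((g ^- n)%g : disc gT) x = x.
Proof.
move=> gx; rewrite -{1}(fixptsX n gx) -(@gactM (disc gT)).
by rewrite [(_ * _)%g]mulVg gact1.
Qed.

Lemma oc_prX (x : T) n : oc_pr (x ^+ n)%g = (oc_pr x ^+ n)%g.
Proof.
elim: n => [|n IH].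
  rewrite !expg0; apply: (mulgI (oc_pr (1%g : T))).
  by rewrite -oc_prM !mulg1.
by rewrite !expgS oc_prM IH.
Qed.

Lemma oc_prV (x : T) : oc_pr (x^-1)%g = ((oc_pr x)^-1)%g.
Proof.
have h1 := oc_prX x 0; rewrite !expg0 in h1.
by apply: (mulgI (oc_pr x)); rewrite -oc_prM !mulgV h1.
Qed.

Lemma in_cycle_fix (u : (Rgrp R * T)%type) x :
  in_cycle (lam_gen R T) u -> fixpts x ->
  gact (cent_val (oc_pr u.2) : disc gT) x = x.
Proof.
have E n : ((lam_gen R T) ^+ n)%g.2 = (celt (oc_lift T) ^+ n)%g.
  by elim: n => // n IH; rewrite !expgS -IH.
have V n : cent_val ((cent_self g ^+ n)%g : cent g) = (g ^+ n)%g.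
  elim: n => [|n IH]; first by rewrite !expg0.
  by rewrite !expgS cent_valM IH cent_selfE.
case=> n [->|->] gx.
  by rewrite E oc_prX oc_liftP V fixptsX.
rewrite [(_ ^- n)%g.2](_ : _ = ((celt (oc_lift T) ^+ n)^-1)%g); last by rewrite -E.
rewrite oc_prV oc_prX oc_liftP.
by rewrite (_ : cent_val _ = (g ^- n)%g) ?fixptsV // -V.
Qed.

Lemma lam_pr_fix (p : (Rgrp R * T)%type) x : fixpts x ->
  gact (lam_pr (cproj _ p : Lam) : disc gT) x
    = gact (cent_val (oc_pr p.2) : disc gT) x.
Proof.
move=> gx; rewrite /lam_pr.
have h := crepr_cproj (Central (@lam_gen_central R gT g T)) p.
set r := crepr _ in h *.
have -> : r = (p * (p^-1 * r))%g by rewrite mulgA mulgV mul1g.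
rewrite [(p * _)%g.2](_ : _ = p.2 * (p^-1 * r)%g.2)%g //.
by rewrite oc_prM cent_valM (@gactM (disc gT)) (in_cycle_fix h gx).
Qed.

Fact lam_act_subproof (q : Lam) (x : fixpts) :
  gact (lam_pr q : disc gT) (\val x) \in fixpts.
Proof.
apply/mem_set; rewrite /fixpts /= -(@gactM (disc gT)) /lam_pr.
rewrite [(_ * _)%g](@cent_valC gT g) (@gactM (disc gT)).
by congr gact; have := set_valP x.
Qed.

(* [h, t] . x = h . x, through any representative of the class *)
Definition lam_act (q : Lam) (x : fixpts) : fixpts :=
  exist _ (gact (lam_pr q : disc gT) (\val x)) (lam_act_subproof q x).

Let act1 x : lam_act 1%g x = x.
Proof.
apply: val_inj => /=; rewrite -cproj1 lam_pr_fix; last exact: set_valP.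
have h := oc_prX (1%g : T) 0; rewrite !expg0 in h.
by rewrite [oc_pr _]h cent_val1 gact1.
Qed.

Let actM p q x : lam_act (p * q)%g x = lam_act p (lam_act q x).
Proof.
apply: val_inj => /=; have gx : fixpts (\val x) by exact: set_valP.
have gqx := set_valP (lam_act q x); rewrite /= in gqx.
move: gqx; rewrite -(creprK p) -(creprK q) -cprojM => gqx.
rewrite (lam_pr_fix _ gx) (lam_pr_fix _ gqx) (lam_pr_fix _ gx).
by rewrite oc_prM cent_valM (@gactM (disc gT)).
Qed.

Let act_cont : continuous (fun px : Lam * fixpts => lam_act px.1 px.2).
Proof.
apply: continuous_to_initial => -[q0 x0] /=.
pose U := [set q : Lam | forall x, fixpts x ->
  gact (lam_pr q : disc gT) x = gact (lam_pr q0 : disc gT) x].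
have oU : open U.
  rewrite /open /= /quotient_open.
  pose V := [set h : cent g | forall x, fixpts x ->
    gact (cent_val h : disc gT) x = gact (lam_pr q0 : disc gT) x].
  have -> : (fun p : (Rgrp R * T)%type => cproj _ p : Lam) @^-1` U
      = (fun p : (Rgrp R * T)%type => oc_pr p.2) @^-1` V.
    apply/seteqP; split=> p /= H x gx; have := H x gx; by rewrite lam_pr_fix.
  apply: open_comp; last exact: (@discrete_open (discrete_topology _)).
  move=> p _; apply: (continuous_compose (@continuous_snd _ _)).
  exact: oc_pr_cont.
have cq0 : continuous (fun px : Lam * fixpts =>
    gact (lam_pr q0 : disc gT) (\val px.2)).
  apply: (continuous_compose (f := fun px : Lam * fixpts =>
    (lam_pr q0 : disc gT, \val px.2)) (g := fun px => gact px.1 px.2));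
    last exact: gact_cont.
  apply: continuous_pair; first by move=> ?; exact: cvg_cst.
  apply: (continuous_compose (@continuous_snd _ _)).
  exact: initial_continuous.
apply: (cvg_trans (near_eq_cvg _)); last exact: cq0.
exists (U, setT) => /=.
  by split; [apply: open_nbhs_nbhs; split | exact: filterT].
by move=> [q x] [/= Uq _]; apply/esym; apply: Uq; exact: set_valP.
Qed.

Definition fix_gspace : gspace Lam := GSpace act1 actM act_cont.
End FixedPoints.

Section Instances.
Context (R : realType) (gT : finGroupType) (g : gT).

Definition cent_self_central : central (cent g) := Central (@cent_selfC gT g).

Definition cent_over : over_cent g :=
  @OverCent gT g (cent g) id (fun _ _ => erefl) (fun _ => cvg_id)
    cent_self_central erefl.

Context (alpha : cocycle3 R gT).

Definition tcent : tgroupType := cext (transgression alpha g).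

Definition tcent_lift : tcent := (1%g : U1 R, cent_self g).

Lemma tcent_liftC (x : tcent) : (tcent_lift * x = x * tcent_lift)%g.
Proof.
have nC h : transgr alpha (cent_self g) h = transgr alpha h (cent_self g).
  rewrite /transgr cent_selfE -!mulgA mulgV mulg1.
  by rewrite u1_mulC -mulgA mulVg mulg1.
by case: x => a h; congr (_, _);
  [rewrite /= nC mul1g mulg1 | exact: cent_selfC].
Qed.

Definition tcent_over : over_cent g :=
  @OverCent gT g tcent snd (fun _ _ => erefl) (@continuous_snd _ _)
    (Central tcent_liftC) erefl.

(* the central circle of Lambda^alpha(g) *)
Definition lam_circle (a : U1 R) : Lambda R tcent_over :=
  cproj _ (1%g : Rgrp R, (a, 1%g) : tcent).

Definition circle_graph : set (Lambda R tcent_over * CC R) :=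
  range (fun a => (lam_circle a, u1val a)).
End Instances.
Arguments circle_graph {R gT} g alpha : rename.

Record vpoint (F : Type) (Y : Type) (rk : Y -> nat) := VPoint {
  vbase : Y ;
  vvec : 'rV[F]_(rk vbase)
}.
Arguments VPoint {F Y rk} vbase vvec.
HB.instance Definition _ F Y rk := gen_eqMixin (@vpoint F Y rk).
HB.instance Definition _ F Y rk := gen_choiceMixin (@vpoint F Y rk).

(* A family of complex vector spaces over Y with a topology on its total space.
   A basis of each fibre is chosen, without any continuity requirement, so that
   the fibre at y is C^(rk y) as a vector space; every bundle is isomorphic to
   one of this form, and bundles over Y then live in the universe of Y, which
   makes them a choiceType. *)
Record vfamily (R : realType) (Y : topologicalType) := VFamily {
  vrk : Y -> nat ;
  vopen : set (set (vpoint (CC R) vrk)) ;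
  vopenT : vopen setT ;
  vopenI : setI_closed vopen ;
  vopenU : forall (I : Type) (f : I -> set (vpoint (CC R) vrk)),
    (forall i, vopen (f i)) -> vopen (\bigcup_i f i)
}.

Definition vtot (R : realType) (Y : topologicalType) (E : vfamily R Y) : Type :=
  vpoint (CC R) (vrk E).
HB.instance Definition _ R Y (E : vfamily R Y) := Choice.on (vtot E).
HB.instance Definition _ R Y (E : vfamily R Y) :=
  isOpenTopological.Build (vtot E) (@vopenT _ _ E) (@vopenI _ _ E) (@vopenU _ _ E).

Section VectorBundles.
Context (R : realType) (Y : topologicalType).

Definition vproj (E : vfamily R Y) (e : vtot E) : Y := vbase e.
Definition vpt (E : vfamily R Y) (y : Y) (v : 'rV[CC R]_(vrk E y)) : vtot E :=
  VPoint y v.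

(* phi and psi are mutually inverse homeomorphisms between the part of E over U
   and U x C^n, over U and linear on fibres. *)
Definition is_chart (E : vfamily R Y) (U : set Y) (n : nat)
    (phi : vtot E -> 'rV[CC R]_n) (psi : Y * 'rV[CC R]_n -> vtot E) : Prop :=
  [/\ {within @vproj E @^-1` U, continuous phi},
      {within U `*` setT, continuous psi},
      forall y, U y -> linear (fun v => phi (@vpt E y v)),
      forall y v, U y -> vproj (psi (y, v)) = y /\ phi (psi (y, v)) = v
    & forall e, U (vproj e) -> psi (vproj e, phi e) = e].

Definition is_vbundle (E : vfamily R Y) : Prop :=
  continuous (@vproj E) /\
  forall y, exists U : set Y, [/\ open U, U y &
    exists n (phi : vtot E -> 'rV[CC R]_n) (psi : Y * 'rV[CC R]_n -> vtot E),
      is_chart U phi psi].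

Definition vmap (E F : vfamily R Y) :=
  forall y, {linear 'rV[CC R]_(vrk E y) -> 'rV[CC R]_(vrk F y)}.

Definition vmap_tot (E F : vfamily R Y) (f : vmap E F) (e : vtot E) : vtot F :=
  VPoint (vbase e) (f (vbase e) (vvec e)).
End VectorBundles.

(* W prescribes the action of some elements of P: if W (p, z), then p acts on
   the fibres as multiplication by z.  There is no prescription in the untwisted
   case; in the twisted case W is the graph of the central circle. *)
Section EquivariantBundles.
Context (R : realType) (P : tgroupType) (W : set (P * CC R)) (Y : gspace P).

Definition fib_action (E : vfamily R Y) :=
  forall (p : P) (y : Y),
    {linear 'rV[CC R]_(vrk E y) -> 'rV[CC R]_(vrk E (gact p y))}.

Definition tot_action (E : vfamily R Y) (a : fib_action E) (p : P) (e : vtot E) :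
    vtot E :=
  VPoint (gact p (vbase e)) (a p (vbase e) (vvec e)).

Record eqbundle := EqBundle {
  bfam :> vfamily R Y ;
  bfam_bundle : is_vbundle bfam ;
  bfibact : fib_action bfam ;
  bact := tot_action bfibact ;
  bact1 : forall e, bact 1%g e = e ;
  bactM : forall p q e, bact (p * q)%g e = bact p (bact q e) ;
  bact_cont : continuous (fun pe : P * vtot bfam => bact pe.1 pe.2) ;
  bactW : forall p z, W (p, z) ->
    forall y (v : 'rV[CC R]_(vrk bfam y)), bact p (VPoint y v) = VPoint y (z *: v)
}.
HB.instance Definition _ := gen_eqMixin eqbundle.
HB.instance Definition _ := gen_choiceMixin eqbundle.

Definition is_bmap (E F : eqbundle) (f : vmap E F) : Prop :=
  continuous (vmap_tot f) /\
  forall p e, vmap_tot f (bact p e) = bact p (vmap_tot f e).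

(* E is isomorphic to the direct sum of E1 and E2.  The inverse of a continuous
   fibrewise isomorphism of vector bundles is continuous. *)
Definition is_dsum (E E1 E2 : eqbundle) : Prop :=
  exists (f1 : vmap E1 E) (f2 : vmap E2 E),
    [/\ is_bmap f1, is_bmap f2 & forall y,
      bijective (fun v : 'rV[CC R]_(vrk E1 y) * 'rV[CC R]_(vrk E2 y) =>
        f1 y v.1 + f2 y v.2)].

(* The subgroup generated by the relations [E] = [E1] + [E2] for E = E1 + E2;
   the Grothendieck group is the quotient of the free abelian group on all
   bundles by it. *)
Inductive K0null : {freeg eqbundle / int} -> Prop :=
| K0null0 : K0null 0
| K0nullB x y : K0null x -> K0null y -> K0null (x - y)
| K0null_dsum E E1 E2 : is_dsum E E1 E2 -> K0null (<< E >> - << E1 >> - << E2 >>).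

Definition K0null_pred : {pred {freeg eqbundle / int}} := fun x => `[< K0null x >].

Fact K0null_zmod_closed : zmod_closed K0null_pred.
Proof.
split=> [|x y /asboolP hx /asboolP hy]; apply/asboolP; first exact: K0null0.
exact: K0nullB.
Qed.
HB.instance Definition _ :=
  GRing.isZmodClosed.Build {freeg eqbundle / int} K0null_pred K0null_zmod_closed.

Definition K0 : zmodType := (Quotient.quot K0null_pred).

Definition K0pi (x : {freeg eqbundle / int}) : K0 := \pi_(Quotient.quot K0null_pred) x.
Definition K0repr (x : K0) : {freeg eqbundle / int} := repr (x : (Quotient.quot K0null_pred)).

Lemma K0reprK x : K0pi (K0repr x) = x.
Proof. exact: (@reprK _ (Quotient.quot K0null_pred)). Qed.

Lemma K0piP x y : K0pi x = K0pi y <-> K0null (x - y).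
Proof.
have E : (x - y \in K0null_pred) = (K0pi x == K0pi y).
  exact: Quotient.idealrBE.
split=> [/eqP h|h]; first by move: h; rewrite -E => /asboolP.
by apply/eqP; rewrite -E; apply/asboolP.
Qed.

Lemma K0piB x y : K0pi (x - y) = K0pi x - K0pi y.
Proof. exact: (raddfB (\pi_(Quotient.quot K0null_pred))). Qed.
End EquivariantBundles.

Section Restriction.
Context (R : realType) (P : tgroupType) (W : set (P * CC R)) (Y : gspace P)
  (S : topologicalType) (s0 : S).
Local Notation YS := (prod_gspace Y S).

Section Family.
Context (E : vfamily R YS).

Definition slice_rk (y : Y) : nat := vrk E (y, s0).
Definition slice_in (e : vpoint (CC R) slice_rk) : vtot E :=
  VPoint ((vbase e, s0) : YS) (vvec e).

Definition slice_out (e : vtot E) : vpoint (CC R) slice_rk :=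
  match pselect (vbase e = ((vbase e).1, s0)) with
  | left eq => VPoint (vbase e).1
      (eq_rect _ (fun q : YS => 'rV[CC R]_(vrk E q)) (vvec e) _ eq)
  | right _ => VPoint (vbase e).1 0
  end.

Lemma slice_inK : cancel slice_in slice_out.
Proof.
case=> y v; rewrite /slice_out /=; case: pselect => [eq|]; last by [].
by rewrite (Prop_irrelevance eq (erefl _)).
Qed.

Lemma slice_outK e : (vbase e).2 = s0 -> slice_in (slice_out e) = e.
Proof.
case: e => -[y s] v /= es; subst s; rewrite /slice_out /=.
by case: pselect => [eq|] //; rewrite (Prop_irrelevance eq (erefl _)).
Qed.

Let S_open : set (set (vpoint (CC R) slice_rk)) :=
  @open (initial_topology slice_in).
Let S_openT : S_open setT. Proof. exact: openT. Qed.
Let S_openI : setI_closed S_open. Proof. by move=> A B; exact: openI. Qed.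
Let S_openU (I : Type) (f : I -> set (vpoint (CC R) slice_rk)) :
  (forall i, S_open (f i)) -> S_open (\bigcup_i f i).
Proof. by move=> h; apply: bigcup_open => i _; exact: h. Qed.

Definition slice_family : vfamily R Y := VFamily S_openT S_openI S_openU.

Lemma slice_in_continuous : continuous (slice_in : vtot slice_family -> vtot E).
Proof. by apply/continuousP => A oA; exists A. Qed.

Lemma to_slice_continuous (A : topologicalType) (f : A -> vtot slice_family) :
  continuous (slice_in \o f : A -> vtot E) -> continuous f.
Proof.
move=> cf; apply/continuousP => _ [V oV <-].
exact: (continuousP _).1 cf V oV.
Qed.

Lemma to_slice_continuous_at (A : topologicalType) (f : A -> vtot slice_family) a :
  (slice_in \o f : A -> vtot E) @ a --> (slice_in (f a) : vtot E) ->
  f @ a --> f a.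
Proof.
move=> cf B; rewrite (@nbhsE (vtot slice_family)) => -[_ [[V oV <-] Vfa] VB].
have nV : nbhs (slice_in (f a) : vtot E) V by apply: open_nbhs_nbhs; split.
have h : nbhs a ((slice_in \o f) @^-1` V) := cf V nV.
suff : nbhs a (f @^-1` B) by [].
by apply: filterS h => x Vx; exact: VB.
Qed.

Lemma slice_bundle : is_vbundle E -> is_vbundle slice_family.
Proof.
move=> [cp lt]; have cp' : continuous (@vproj R Y slice_family).
  exact: (continuous_compose (continuous_compose slice_in_continuous cp)
    (@continuous_fst Y S)).
have cs : continuous (fun y : Y => ((y, s0) : YS)).
  apply: (@continuous_pair Y Y S); first by move=> ?; exact: cvg_id.
  by move=> ?; exact: cvg_cst.
split=> // y0; have [U [oU Uy [n [phi [psi [c1 c2 c3 c4 c5]]]]]] := lt (y0, s0).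
pose U' : set Y := fun y => U (y, s0).
have oU' : open U' by exact: open_comp (fun y _ => cs y) oU.
exists U'; split=> //; exists n, (fun e => phi (slice_in e)),
  (fun yv => slice_out (psi ((yv.1, s0), yv.2))); split.
- rewrite continuous_open_subspace; last exact: open_comp (fun e _ => cp' e) oU'.
  move=> e /set_mem Ue; apply: (@continuous_comp _ _ _ _ phi).
    exact: slice_in_continuous.
  move: c1; rewrite continuous_open_subspace; last exact: open_comp (fun e _ => cp e) oU.
  by apply; apply/mem_set.
- have oX (Z : topologicalType) (V : set Z) : open V ->
      open (V `*` [set: 'rV[CC R]_n]).
    move=> oV; have -> : V `*` [set: 'rV[CC R]_n] = fst @^-1` V.
      by apply/seteqP; split=> -[? ?] //= [].
    by apply: open_comp oV => ? _; exact: continuous_fst.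
  move: c2; rewrite !continuous_open_subspace; [|exact: oX|exact: oX].
  move=> c2 [y v] /set_mem [/= Uy' _].
  apply: to_slice_continuous_at; rewrite /=.
  have e1 : slice_in (slice_out (psi ((y, s0), v))) = psi ((y, s0), v).
    by apply: slice_outK; rewrite [vbase _](c4 (y, s0) v Uy').1.
  rewrite e1.
  apply: (cvg_trans (near_eq_cvg (f := fun yv : Y * 'rV[CC R]_n =>
    psi ((yv.1, s0), yv.2)) _)).
    have : nbhs (y, v) (U' `*` [set: 'rV[CC R]_n]).
      by apply: open_nbhs_nbhs; split => //; exact: oX.
    apply: filterS => -[y' v'] [/= Uy'' _]; apply/esym.
    by apply: slice_outK; rewrite [vbase _](c4 (y', s0) v' Uy'').1.
  pose k (yv : Y * 'rV[CC R]_n) : YS * 'rV[CC R]_n := ((yv.1, s0), yv.2).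
  have ck : continuous k.
    apply: continuous_pair; last exact: continuous_snd.
    exact: (continuous_compose (@continuous_fst _ _) cs).
  apply: (@continuous_comp _ _ _ k psi (y, v) (ck (y, v))).
  by apply: c2; apply/mem_set; split.
- by move=> y Uy' a v w; exact: (c3 (y, s0) Uy' a v w).
- move=> y v Uy'; have [h1 h2] := c4 (y, s0) v Uy'.
  have h3 := @slice_outK (psi ((y, s0), v)); rewrite [vbase _]h1 in h3.
  have {}h3 := h3 erefl; split; last by rewrite h3.
  by have := congr1 (fun e => (vbase e).1) h3; rewrite [vbase (psi _)]h1.
- move=> e Ue; apply: (can_inj slice_inK); rewrite slice_outK.
    exact: (c5 (slice_in e)).
  by rewrite [psi _](c5 (slice_in e)).
Qed.
End Family.

Section Bundle.
Context (E : eqbundle W YS).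

Let F := slice_family E.
Let fibact : fib_action (Y := Y) F := fun p y => @bfibact _ _ _ _ E p (y, s0).
Let sliceE p e : slice_in (tot_action fibact p e) = bact p (slice_in e).
Proof. by []. Qed.
Let act1 e : tot_action fibact 1%g e = e.
Proof. by apply: (can_inj (@slice_inK E)); rewrite sliceE bact1. Qed.
Let actM p q e :
  tot_action fibact (p * q)%g e = tot_action fibact p (tot_action fibact q e).
Proof. by apply: (can_inj (@slice_inK E)); rewrite !sliceE bactM. Qed.
Let act_cont : continuous (fun pe : P * vtot F => tot_action fibact pe.1 pe.2).
Proof.
apply: to_slice_continuous.
apply: (continuous_compose (f := fun pe : P * vtot F => (pe.1, slice_in pe.2))
  (g := fun pe : P * vtot E => bact pe.1 pe.2)); last exact: bact_cont.
apply: continuous_pair; first exact: continuous_fst.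
exact: (continuous_compose (@continuous_snd _ _) (@slice_in_continuous E)).
Qed.
Let actW p z : W (p, z) -> forall y (v : 'rV[CC R]_(vrk F y)),
  tot_action fibact p (VPoint y v) = VPoint y (z *: v).
Proof.
move=> wpz y v; apply: (can_inj (@slice_inK E)); rewrite sliceE.
exact: (bactW wpz).
Qed.

Definition slice : eqbundle W Y :=
  EqBundle (slice_bundle (bfam_bundle E)) act1 actM act_cont actW.
End Bundle.

Lemma slice_dsum E E1 E2 : is_dsum E E1 E2 -> is_dsum (slice E) (slice E1) (slice E2).
Proof.
have sl (A B : eqbundle W YS) (f : vmap A B) : is_bmap f ->
    is_bmap ((fun y => f (y, s0)) : vmap (slice A) (slice B)).
  move=> [cf ef]; split=> [|p e].
    apply: to_slice_continuous.
    exact: (continuous_compose (@slice_in_continuous A) cf).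
  by apply: (can_inj (@slice_inK B)); exact: (ef p (slice_in e)).
case=> f1 [f2 [m1 m2 b]].
exists (fun y => f1 (y, s0)), (fun y => f2 (y, s0)); split.
- exact: sl.
- exact: sl.
- by move=> y; exact: b.
Qed.

Definition slice_free (x : {freeg (eqbundle W YS) / int}) :
    {freeg (eqbundle W Y) / int} :=
  fglift (fun E => << slice E >>) x.

Lemma slice_freeB x y : slice_free (x - y) = slice_free x - slice_free y.
Proof. exact: lift_is_additive. Qed.

Lemma slice_freeU E : slice_free << E >> = << slice E >>.
Proof. by rewrite /slice_free liftU scale1r. Qed.

Lemma slice_free_null x : K0null x -> K0null (slice_free x).
Proof.
elim=> [|{}x y _ hx _ hy|E E1 E2 h].
- by rewrite -(subrr 0) slice_freeB subrr; exact: K0null0.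
- by rewrite slice_freeB; exact: K0nullB.
- by rewrite !slice_freeB !slice_freeU; apply: K0null_dsum; exact: slice_dsum.
Qed.

Definition K0res (x : K0 W YS) : K0 W Y := K0pi (slice_free (K0repr x)).

Lemma K0res_pi x : K0res (K0pi x) = K0pi (slice_free x).
Proof.
apply/K0piP; rewrite -slice_freeB; apply: slice_free_null.
by apply/K0piP; rewrite K0reprK.
Qed.

Fact K0res_zmod_morphism : zmod_morphism K0res.
Proof.
move=> x y; rewrite -(K0reprK x) -(K0reprK y) -K0piB !K0res_pi -K0piB.
by rewrite slice_freeB.
Qed.
HB.instance Definition _ :=
  GRing.isZmodMorphism.Build (K0 W YS) (K0 W Y) K0res K0res_zmod_morphism.
End Restriction.

Definition sphere (R : realType) (n : nat) : topologicalType :=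
  set_type [set v : 'rV[R]_n.+1 | \sum_i v 0 i ^+ 2 = 1].

Fact sphere_base_subproof (R : realType) (n : nat) :
  (delta_mx 0 0 : 'rV[R]_n.+1) \in [set v : 'rV[R]_n.+1 | \sum_i v 0 i ^+ 2 = 1].
Proof.
apply/mem_set => /=; rewrite (bigD1 0) //= mxE !eqxx expr1n big1 ?addr0 // => i i0.
by rewrite mxE (negbTE i0) andbF expr0n.
Qed.

Definition sphere_base (R : realType) (n : nat) : sphere R n :=
  exist _ (delta_mx 0 0) (sphere_base_subproof R n).

(* K^(-n)(Y) is the kernel of the restriction from K(Y x S^n) to
   K(Y x base point) = K(Y); for n = 0 this is K(Y), as S^0 has two points. *)
Section Degrees.
Context (R : realType) (P : tgroupType) (W : set (P * CC R)) (Y : gspace P)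
  (n : nat).

Definition Kker : {pred K0 W (prod_gspace Y (sphere R n))} :=
  fun x => K0res (sphere_base R n) x == 0.

Fact Kker_zmod_closed : zmod_closed Kker.
Proof.
split=> [|x y]; rewrite !unfold_in /Kker; first by rewrite raddf0.
by move=> /eqP hx /eqP hy; rewrite K0res_zmod_morphism hx hy subrr.
Qed.
HB.instance Definition _ := GRing.isZmodClosed.Build _ Kker Kker_zmod_closed.

Record Kneg := MkKneg {
  kneg_val :> K0 W (prod_gspace Y (sphere R n)) ;
  _ : kneg_val \in Kker
}.
HB.instance Definition _ := [isSub for kneg_val].
HB.instance Definition _ := [Choice of Kneg by <:].
HB.instance Definition _ := [SubChoice_isSubZmodule of Kneg by <:].
End Degrees.

(* Positive degrees are defined by Bott periodicity, K^n = K^(n - 2n). *)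
Definition Kdeg (R : realType) (P : tgroupType) (W : set (P * CC R))
  (Y : gspace P) (n : int) : zmodType := Kneg W Y `|n|%N.

Definition dprod (I : Type) (M : I -> zmodType) : Type := forall i, M i.

Section Dprod.
Context (I : Type) (M : I -> zmodType).
HB.instance Definition _ := gen_eqMixin (dprod M).
HB.instance Definition _ := gen_choiceMixin (dprod M).
Let zero : dprod M := fun i => 0.
Let opp (x : dprod M) : dprod M := fun i => - x i.
Let add (x y : dprod M) : dprod M := fun i => x i + y i.
Let addA : associative add.
Proof. by move=> x y z; apply: functional_extensionality_dep => i; exact: addrA. Qed.
Let addC : commutative add.
Proof. by move=> x y; apply: functional_extensionality_dep => i; exact: addrC. Qed.
Let add0 : left_id zero add.
Proof. by move=> x; apply: functional_extensionality_dep => i; exact: add0r. Qed.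
Let addN : left_inverse zero opp add.
Proof. by move=> x; apply: functional_extensionality_dep => i; exact: addNr. Qed.
HB.instance Definition _ := GRing.isZmodule.Build (dprod M) addA addC add0 addN.
End Dprod.

(* reps is meant to be a set of representatives of the conjugacy classes. *)
Section QEll.
Context (R : realType) (gT : finGroupType) (X : gspace (disc gT))
  (reps : {set gT}) (n : int).

Definition QEll : zmodType :=
  dprod (fun g : {g : gT | g \in reps} =>
    Kdeg (set0 : set (Lambda R (cent_over (val g)) * CC R))
      (fix_gspace R (cent_over (val g)) X) n).

Definition QEll_tw (alpha : cocycle3 R gT) : zmodType :=
  dprod (fun g : {g : gT | g \in reps} =>
    Kdeg (circle_graph (val g) alpha)
      (fix_gspace R (tcent_over (val g) alpha) X) n).
End QEll.

(* (a, b, c, d) stands for a + b i + c j + d k *)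
Definition quat (R : realType) : Type := (R * R * R * R)%type.
HB.instance Definition _ (R : realType) :=
  Topological.copy (quat R) (R * R * R * R)%type.

Section Quaternions.
Context (R : realType).

Definition qmul (x y : quat R) : quat R :=
  let: (a, b, c, d) := x in
  let: (a', b', c', d') := y in
  (a * a' - b * b' - c * c' - d * d',
   a * b' + b * a' + c * d' - d * c',
   a * c' - b * d' + c * a' + d * b',
   a * d' + b * c' - c * b' + d * a').

Definition qone : quat R := (1, 0, 0, 0).
Definition qconj (x : quat R) : quat R :=
  let: (a, b, c, d) := x in (a, - b, - c, - d).
Definition qnorm2 (x : quat R) : R :=
  let: (a, b, c, d) := x in a ^+ 2 + b ^+ 2 + c ^+ 2 + d ^+ 2.

Lemma qmulA : associative qmul.
Proof.
move=> [[[a b] c] d] [[[a' b'] c'] d'] [[[a'' b''] c''] d''] /=.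
by congr (_, _, _, _); ring.
Qed.
Lemma qmul1x : left_id qone qmul.
Proof. by move=> [[[a b] c] d] /=; congr (_, _, _, _); ring. Qed.
Lemma qmulx1 : right_id qone qmul.
Proof. by move=> [[[a b] c] d] /=; congr (_, _, _, _); ring. Qed.
Lemma qnorm2M x y : qnorm2 (qmul x y) = qnorm2 x * qnorm2 y.
Proof. by move: x y => [[[a b] c] d] [[[a' b'] c'] d'] /=; ring. Qed.
Lemma qnorm2J x : qnorm2 (qconj x) = qnorm2 x.
Proof. by move: x => [[[a b] c] d] /=; ring. Qed.
Lemma qnorm21 : qnorm2 qone = 1.
Proof. by rewrite /=; ring. Qed.
Lemma qconj_mul x : qnorm2 x = 1 -> qmul (qconj x) x = qone.
Proof.
move: x => [[[a b] c] d] /= h; rewrite /qone -h.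
by congr (_, _, _, _); ring.
Qed.
Lemma qmul_conj x : qnorm2 x = 1 -> qmul x (qconj x) = qone.
Proof.
move: x => [[[a b] c] d] /= h; rewrite /qone -h.
by congr (_, _, _, _); ring.
Qed.

Lemma qmul_continuous x : continuous (qmul x).
Proof.
move: x => [[[a b] c] d].
pose p1 (y : quat R) : R := (y : R * R * R * R).1.1.1.
pose p2 (y : quat R) : R := (y : R * R * R * R).1.1.2.
pose p3 (y : quat R) : R := (y : R * R * R * R).1.2.
pose p4 (y : quat R) : R := (y : R * R * R * R).2.
have f1 : continuous (fst : quat R -> R * R * R) by exact: continuous_fst.
have f2 := continuous_compose f1 (@continuous_fst _ _).
have c1 : continuous p1 := continuous_compose f2 (@continuous_fst _ _).
have c2 : continuous p2 := continuous_compose f2 (@continuous_snd _ _).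
have c3 : continuous p3 := continuous_compose f1 (@continuous_snd _ _).
have c4 : continuous p4 by exact: continuous_snd.
have lin (u v w z : R) :
    continuous (fun y => u * p1 y + v * p2 y + w * p3 y + z * p4 y).
  by move=> y; do ?apply: cvgD; apply: cvgMr; [exact: c1|exact: c2|exact: c3|exact: c4].
have -> : qmul (a, b, c, d) = fun y =>
  (((a * p1 y + (- b) * p2 y + (- c) * p3 y + (- d) * p4 y,
     b * p1 y + a * p2 y + (- d) * p3 y + c * p4 y),
     c * p1 y + d * p2 y + a * p3 y + (- b) * p4 y),
     d * p1 y + (- c) * p2 y + b * p3 y + a * p4 y).
  apply/funext => -[[[a' b'] c'] d']; rewrite /p1 /p2 /p3 /p4 /=.
  by congr (_, _, _, _); ring.
by do 3!(apply: continuous_pair; last exact: lin); exact: lin.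
Qed.
End Quaternions.

(* SU(2), as the group of unit quaternions *)
Record uquat (R : realType) := MkUquat {
  uqval :> quat R ;
  uqP : qnorm2 uqval == 1
}.
HB.instance Definition _ R := [isSub for @uqval R].
HB.instance Definition _ R := [Choice of uquat R by <:].

Section UnitQuaternions.
Context (R : realType).
Implicit Types x y : uquat R.

Fact uq_one_subproof : qnorm2 (qone R) == 1. Proof. by rewrite qnorm21. Qed.
Fact uq_mul_subproof x y : qnorm2 (qmul x y) == 1.
Proof. by rewrite qnorm2M (eqP (uqP x)) (eqP (uqP y)) mulr1. Qed.
Fact uq_inv_subproof x : qnorm2 (qconj x) == 1.
Proof. by rewrite qnorm2J uqP. Qed.

Let one := MkUquat uq_one_subproof.
Let mul x y := MkUquat (uq_mul_subproof x y).
Let inv x := MkUquat (uq_inv_subproof x).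
Let mulA : associative mul.
Proof. by move=> x y z; apply: val_inj; exact: qmulA. Qed.
Let mul1 : left_id one mul.
Proof. by move=> x; apply: val_inj; exact: qmul1x. Qed.
Let mulr1 : right_id one mul.
Proof. by move=> x; apply: val_inj; exact: qmulx1. Qed.
Let mulV : left_inverse one inv mul.
Proof. by move=> x; apply: val_inj; exact: qconj_mul (eqP (uqP x)). Qed.
Let mulrV : right_inverse one inv mul.
Proof. by move=> x; apply: val_inj; exact: qmul_conj (eqP (uqP x)). Qed.
HB.instance Definition _ := isGroup.Build (uquat R) mulA mul1 mulr1 mulV mulrV.

Lemma uqM x y : uqval (x * y)%g = qmul x y. Proof. by []. Qed.
Lemma uq1 : uqval (1%g : uquat R) = qone R. Proof. by []. Qed.
End UnitQuaternions.

Record finsubg (P : groupType) := FinSubg {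
  fsset : {fset P} ;
  fsset1 : 1%g \in fsset ;
  fssetM : forall x y, x \in fsset -> y \in fsset -> (x * y)%g \in fsset ;
  fssetV : forall x, x \in fsset -> (x^-1)%g \in fsset
}.

Definition fsgT (P : groupType) (G : finsubg P) : Type := fset_sub_type (fsset G).
HB.instance Definition _ (P : groupType) (G : finsubg P) :=
  Finite.copy (fsgT G) (fset_sub_type (fsset G)).

Definition fsval (P : groupType) (G : finsubg P) (x : fsgT G) : P :=
  fsval (x : fset_sub_type (fsset G)).

Section FiniteSubgroup.
Context (P : groupType) (G : finsubg P).
Implicit Types x y : fsgT G.
Let inG x : fsval x \in fsset G. Proof. exact: valP x. Qed.
Let mul x y : fsgT G := FSetSub (fssetM (inG x) (inG y)).
Let one : fsgT G := FSetSub (fsset1 G).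
Let inv x : fsgT G := FSetSub (fssetV (inG x)).
Let mulA : associative mul.
Proof. by move=> x y z; apply: val_inj; exact: mulgA. Qed.
Let mul1 : left_id one mul.
Proof. by move=> x; apply: val_inj; exact: mul1g. Qed.
Let mulV : left_inverse one inv mul.
Proof. by move=> x; apply: val_inj; exact: mulVg. Qed.
HB.instance Definition _ := Finite_isGroup.Build (fsgT G) mulA mul1 mulV.

Lemma fsvalM x y : fsval (x * y)%g = (fsval x * fsval y)%g. Proof. by []. Qed.
Lemma fsval1 : fsval (1%g : fsgT G) = 1%g. Proof. by []. Qed.
End FiniteSubgroup.

(* S^4, the unit sphere of H + R, with g . (y, s) = (g y, s) *)
Section S4.
Context (R : realType) (G : finsubg (uquat R)).

Definition S4_set : set (quat R * R) := [set ys | qnorm2 ys.1 + ys.2 ^+ 2 = 1].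

Fact S4_act_subproof (g : disc (fsgT G)) (x : S4_set) :
  (qmul (fsval (g : fsgT G)) (\val x).1, (\val x).2) \in S4_set.
Proof.
apply/mem_set; rewrite /S4_set /= qnorm2M (eqP (uqP _)) mul1r.
by have := set_valP x.
Qed.

Definition S4_act (g : disc (fsgT G)) (x : S4_set) : S4_set :=
  exist _ (qmul (fsval (g : fsgT G)) (\val x).1, (\val x).2) (S4_act_subproof g x).

Let act1 x : S4_act 1%g x = x.
Proof.
apply: val_inj; case: x => -[y s] h.
by congr (_, _); exact: qmul1x.
Qed.
Let actM g h x : S4_act (g * h)%g x = S4_act g (S4_act h x).
Proof. by apply: val_inj; congr (_, _); rewrite /= -qmulA. Qed.
Let act_cont : continuous (fun gx : disc (fsgT G) * S4_set => S4_act gx.1 gx.2).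
Proof.
apply: continuous_disc => g; apply: continuous_to_initial.
have cv : continuous (\val : S4_set -> quat R * R) by exact: initial_continuous.
apply: (continuous_pair (f := fun x : S4_set => qmul (fsval (g : fsgT G)) (\val x).1)
  (g := fun x : S4_set => (\val x).2)); last first.
  exact: (continuous_compose cv (@continuous_snd _ _)).
apply: (continuous_compose (continuous_compose cv (@continuous_fst _ _))).
exact: qmul_continuous.
Qed.

Definition S4 : gspace (disc (fsgT G)) := GSpace act1 actM act_cont.
End S4.

(* Main.v *)
Require Import Defs.
From HB Require Import structures.
From mathcomp Require Import all_boot all_order all_algebra all_fingroup finmap.
From mathcomp Require Import cyclic ring lra zify.
From mathcomp Require Import all_classical reals topology normedtype trigo.
From mathcomp Require Import complex freeg.
Import numFieldNormedType.Exports.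
Import Order.TTheory GRing.Theory Num.Theory.

Set Implicit Arguments.
Unset Strict Implicit.
Unset Printing Implicit Defensive.

(** The two theories are compared one conjugacy class at a time.  Over g, a
    twisted class is represented by bundles acted on by Lambda^alpha(g) whose
    central circle acts by scalars.  Let chi be a continuous homomorphism from
    Lambda^alpha(g) to U(1) which is the identity on that circle.  Multiplying
    the action on a twisted bundle by chi^-1 makes the circle act trivially, so
    that the action descends to Lambda(g); multiplying by chi goes back.  Both
    operations keep the underlying family of vector spaces, are strictly inverse
    to each other, respect direct sums and commute with restriction to a slice
    of a product, hence induce isomorphisms of K-groups in every degree
    ([rescale], [rescaleK], [slice_rescale], [Kneg_iso]).

    A character chi comes from two choices.  A function beta on C(g) with
    beta(h) beta(k) = theta_g(h, k) beta(hk) gives the homomorphism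
    (a, h) |-> a beta(h) on C^alpha(g).  It is then multiplied by a character of
    R with value beta(g)^-1 at -1 ([Rchar_exists]), so that the product is
    trivial on the generator (-1, (0, g)) of the subgroup that is divided out.

    So everything rests on the triviality of theta_g as a 2-cocycle on C(g), and
    indeed every 2-cocycle with values in U(1) on a finite subgroup H of SU(2)
    is a coboundary ([coboundary_uquat]).  This is often deduced from the
    periodicity of the cohomology of groups acting freely on a sphere; the
    argument here is elementary.  If H acts on a finite set Y and theta is a
    coboundary on each stabiliser, then theta^|Y| is a coboundary ([transfer]).
    Let Z be the intersection of H with {1, -1}.  The translation action of H on
    H/Z has stabiliser Z everywhere.  In the conjugation action of H on the
    cosets other than Z itself, the stabiliser of {x, -x} is either the
    centraliser of x, which is cyclic because commuting quaternions span a copy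
    of the complex numbers, or is obtained from it by adjoining an element that
    inverts it and does not square to 1, a generalised quaternion group.  Every
    central extension of such a stabiliser by U(1) splits ([splits_cyclic],
    [splits_quaternion]).  The two sets have cardinals that differ by one, so
    theta is a quotient of two coboundaries. *)

(** * Cocycles on finite groups and their central extensions *)

Lemma u1X (R : realType) (x : U1 R) n : u1val (x ^+ n)%g = (u1val x ^+ n)%R.
Proof. by elim: n => [|n IH]; rewrite ?expg0 ?expr0 // expgS exprS u1M IH. Qed.

Lemma u1_root (R : realType) (c : U1 R) (n : nat) : (0 < n)%N ->
  exists d : U1 R, (d ^+ n)%g = c.
Proof.
move=> n0; have d1 : `|n.-root (u1val c)|%R == 1%R.
  rewrite -(pexpr_eq1 n0) ?normr_ge0 // -normrX rootCK //.
  exact: u1P.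
exists (MkU1 d1); apply: val_inj => /=.
rewrite u1X; exact: rootCK.
Qed.

(** A constant of its own for the product of U(1), to carry the commutative
    structure that big operators require. *)
Definition u1mul (R : realType) (a b : U1 R) : U1 R := (a * b)%g.
HB.instance Definition _ (R : realType) := Monoid.isComLaw.Build (U1 R) 1%g
  (@u1mul R) (@mulgA (U1 R)) (@u1_mulC R) (@mul1g (U1 R)).

Lemma big_u1_const (R : realType) (I : finType) (A : {set I}) (a : U1 R) :
  \big[@u1mul R/1%g]_(i in A) a = (a ^+ #|A|)%g.
Proof.
by rewrite big_const; elim: #|A| => [|n IH] /=; rewrite ?expg0 // expgS -IH.
Qed.

Section Splitting.
Context (R : realType) (hT : finGroupType) (theta : cocycle2 R (disc hT)).
Local Open Scope group_scope.
Local Notation E := (cext theta).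
Implicit Types (h k : hT).

Definition pr (x : E) : hT := x.2.
Definition emb (a : U1 R) : E := (a, 1).

Lemma prM (x y : E) : pr (x * y) = pr x * pr y. Proof. by []. Qed.
Lemma prV (x : E) : pr x^-1 = (pr x)^-1. Proof. by []. Qed.
Lemma prX (x : E) n : pr (x ^+ n) = pr x ^+ n.
Proof. by elim: n => [|n IH]; rewrite ?expg0 // !expgS prM IH. Qed.

Lemma embM a b : emb (a * b) = emb a * emb b.
Proof. by congr (_, _); rewrite /= ?coc2_1l ?mulg1. Qed.
Lemma embX a n : emb (a ^+ n) = emb a ^+ n.
Proof. by elim: n => [|n IH]; rewrite ?expg0 // !expgS embM IH. Qed.
Lemma emb_inj : injective emb. Proof. by move=> a b []. Qed.

Lemma embC a (x : E) : emb a * x = x * emb a.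
Proof.
case: x => b h; congr (_, _) => /=; last by rewrite mul1g mulg1.
by rewrite coc2_1l coc2_1r !mulg1 u1_mulC.
Qed.

(** Two lifts of the same element differ by a central scalar; equations in the
    extension are solved below up to such a scalar, which is then absorbed. *)
Lemma same_fibre (x y : E) : pr x = pr y -> exists a, x = emb a * y.
Proof.
case: x y => [a h] [b k] /= e; exists (a * b^-1); congr (_, _) => /=.
  by rewrite coc2_1l mulg1 mulgVK.
by rewrite mul1g.
Qed.

(** The restriction of the cocycle to S is trivial: its central extension has a
    multiplicative section over S. *)
Definition splits_on (S : {set hT}) :=
  exists s : hT -> E, {in S, forall h, pr (s h) = h} /\
    {in S &, {morph s : h k / h * k}}.

Lemma splits_onS (S T : {set hT}) : S \subset T -> splits_on T -> splits_on S.
Proof.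
move=> /fintype.subsetP ST [s [sP sM]]; exists s; split=> [h /ST|h k /ST hS /ST kS].
  exact: sP.
exact: sM.
Qed.

Lemma split_cycle (u : hT) (x : E) : pr x = u -> x ^+ #[u] = 1 ->
  exists s : hT -> E, [/\ {in <[u]>, forall h, pr (s h) = h},
    {in <[u]> &, {morph s : h k / h * k}} & s u = x].
Proof.
move=> xu xn; pose ind h := find (fun i => u ^+ i == h) (iota 0 #[u]).
have indP h : h \in <[u]> -> u ^+ ind h = h.
  move=> /cyclePmin [m mn ->].
  have hs : has (fun i => u ^+ i == u ^+ m) (iota 0 #[u]).
    by apply/hasP; exists m => //; rewrite mem_iota.
  have := nth_find 0 hs; rewrite nth_iota ?add0n; last first.
    by move: hs; rewrite has_find size_iota.
  by move/eqP.
have xE m : x ^+ (m %% #[u]) = x ^+ m.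
  by rewrite [in RHS](divn_eq m #[u]) expgD mulnC expgM xn expg1n mul1g.
have xeq m n : u ^+ m = u ^+ n -> x ^+ m = x ^+ n.
  by move=> /eqP; rewrite eq_expg_mod_order => /eqP e; rewrite -xE e xE.
exists (fun h => x ^+ ind h); split.
- by move=> h /indP hh; rewrite prX xu.
- move=> h k hu ku /=; rewrite -expgD; apply: xeq.
  by rewrite expgD !indP // groupM.
- by rewrite -[RHS]expg1; apply: xeq; rewrite indP ?cycle_id.
Qed.

(** The n-th power of a lift of a generator of order n is a scalar, which
    disappears once the lift is divided by one of its n-th roots. *)
Lemma splits_cyclic (A : {group hT}) : cyclic A -> splits_on A.
Proof.
case/cyclicP => u ->.
have [c cE] : exists c, ((1, u) : E) ^+ #[u] = emb c.
  have [|c ->] := @same_fibre (((1, u) : E) ^+ #[u]) 1; last by exists c; rewrite mulg1.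
  by rewrite prX expg_order.
have [d dE] := u1_root c^-1 (order_gt0 u).
have [||s [s1 s2 _]] := @split_cycle u (emb d * (1, u)); last by exists s.
  by rewrite prM mul1g.
rewrite expgMn; last exact: embC.
by rewrite -embX dE cE -embM mulVg.
Qed.

(** Lifts x of a generator of A and J of j can be rescaled so that conjugation
    by J inverts x, and so that the square of J is the power x^m lying over the
    square of j.  As x^m commutes with J, it is its own inverse; since j does not
    square to 1, 2m is exactly the order of A, so that x and J satisfy the
    relations of the generalised quaternion group and A, j lift together. *)
Lemma splits_quaternion (A : {group hT}) (j : hT) (S : {set hT}) :
  cyclic A -> {in A, forall h, h ^ j = h^-1} -> j * j \in A -> j * j != 1 ->
  (forall h, h \in S -> h \in A \/ h * j^-1 \in A) -> splits_on S.
Proof.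
case/cyclicP => u -> invA jjA jj1 SA.
have uu : u \in <[u]> := cycle_id u.
have jA : j \notin <[u]>.
  apply: contra jj1 => /invA; rewrite conjgE mulKg => jV.
  by rewrite {1}jV mulVg.
pose x0 : E := (1, u); pose J0 : E := (1, j).
have [|c cE] := @same_fibre (J0^-1 * x0 * J0) x0^-1.
  by change (j^-1 * u * j = u^-1); rewrite -(invA u uu) conjgE mulgA.
have [d dE] := u1_root c (ltn0Sn 1).
pose x := emb d^-1 * x0.
have prx : pr x = u by rewrite prM mul1g.
have dd : c * d^-1 * d^-1 = 1 by rewrite -dE expgS expg1 mulgK mulgV.
have xJ0 : J0^-1 * x * J0 = x^-1.
  rewrite /x mulgA -embC -2!mulgA (mulgA _ x0) cE.
  have -> : x0^-1 = emb d^-1 * (emb d^-1 * x0)^-1.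
    by rewrite invMg (embC d^-1) mulgVK.
  by rewrite mulgA mulgA -!embM -[d^-1 * c * _]mulgA u1_mulC dd mul1g.
move: x prx xJ0 => {dd dE cE c d x0} x prx xJ0.
have [m mn mE] := cyclePmin jjA.
have [|e eE] := @same_fibre (J0 * J0) (x ^+ m).
  by rewrite prM prX prx.
have [f fE] := u1_root e (ltn0Sn 1).
pose J := emb f^-1 * J0.
have prJ : pr J = j by rewrite prM mul1g.
have JJ : J * J = x ^+ m.
  have -> : J * J = emb (f^-1 * f^-1) * (J0 * J0).
    by rewrite /J embM -!mulgA (mulgA J0) -embC !mulgA.
  by rewrite eE mulgA -embM -fE expgS expg1 mulgA mulgVK mulVg mul1g.
have xJ : x * J = J * x^-1.
  have xJ0' : x * J0 = J0 * x^-1 by rewrite -xJ0 !mulgA mulgV mul1g.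
  by rewrite /J mulgA -embC -!mulgA xJ0'.
move: J prJ JJ xJ => {fE eE e f J0 xJ0} J prJ JJ xJ.
have Jx : J * x = x^-1 * J.
  by apply: (mulgI x); rewrite !mulgA xJ mulgVK mulgV mul1g.
have JxV (i : nat) : J * x ^+ i = x ^- i * J.
  rewrite -expgVn; elim: i => [|i IH]; first by rewrite !expg0 mul1g mulg1.
  by rewrite !expgS mulgA Jx -mulgA IH mulgA.
have x2m : x ^+ (m + m) = 1.
  have e1 : J * x ^+ m = x ^+ m * J by rewrite -JJ mulgA.
  have e2 := JxV m; rewrite e1 in e2; have e3 := mulIg J _ _ e2.
  by rewrite expgD {1}e3 mulVg.
have m0 : (0 < m)%N.
  by rewrite lt0n; apply: contra jj1 => /eqP m0; rewrite mE m0 expg0.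
have nE : (m + m)%N = #[u].
  have := congr1 pr x2m; rewrite prX prx => /eqP; rewrite -order_dvdn.
  case/dvdnP=> -[|[|q]] qE; first by move: m0 qE; rewrite mul0n; lia.
    by rewrite qE mul1n.
  by move: qE mn; rewrite !mulSn; lia.
have xn : x ^+ #[u] = 1 by rewrite -nE.
have xV (i : nat) : x ^- i = x ^+ (#[u].-1 * i).
  rewrite -expgVn expgM; congr (_ ^+ _); apply: (mulgI x).
  by rewrite mulgV -expgS prednK ?order_gt0.
have uV (i : nat) : u ^- i = u ^+ (#[u].-1 * i) 
  by have := congr1 pr (xV i); rewrite prV !prX prx.
have [s [s1 s2 su]] := split_cycle prx xn.
have sX (i : nat) : s (u ^+ i) = x ^+ i.
  elim: i => [|i IH]; last by rewrite !expgS s2 ?mem_cycle // IH su.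
  have := s2 1 1 (group1 _) (group1 _); rewrite mulg1 !expg0 => e1.
  by apply: (mulgI (s 1)); rewrite -e1 mulg1.
have ju (i : nat) : j * u ^+ i = u ^- i * j.
  by have := congr1 pr (JxV i); rewrite !prM prV !prX prx prJ.
pose t h : E := if h \in <[u]> then s h else s (h * j^-1) * J.
have t1 (i : nat) : t (u ^+ i) = x ^+ i by rewrite /t mem_cycle sX.
have t2 (i : nat) : t (u ^+ i * j) = x ^+ i * J.
  by rewrite /t groupMl ?mem_cycle // (negbTE jA) mulgK sX.
exists t; split=> [h|h k].
  rewrite /t; case: ifP => [hA _|hA /SA]; first exact: s1.
  by rewrite hA => -[//|hA']; rewrite prM s1 // prJ mulgVK.
have SE h' : h' \in S -> exists i, h' = u ^+ i \/ h' = u ^+ i * j.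
  case/SA => /cycleP [i iE]; exists i; [by left | right].
  by rewrite -iE mulgVK.
move=> /SE [i [->|->]] /SE [l [->|->]] /=.
- by rewrite -expgD !t1 expgD.
- by rewrite mulgA -expgD t2 t1 t2 expgD mulgA.
- by rewrite -mulgA ju uV mulgA -expgD !t2 t1 -[RHS]mulgA JxV xV mulgA expgD.
- rewrite mulgA -(mulgA _ j) ju uV mulgA -expgD -(mulgA _ j) mE -expgD.
  by rewrite t1 !t2 mulgA -(mulgA _ J) JxV xV mulgA -(mulgA _ J) JJ -!expgD.
Qed.

Definition trivial_power (n : nat) :=
  exists B : hT -> U1 R, forall h k, B h * B k = theta h k ^+ n * B (h * k).

(** Choose a point r in each orbit, an element c(y) carrying r to y, and a
    section over the stabiliser of r.  Moving c(y) g past c(y g) in the extension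
    costs an element of the stabiliser of r, lifted by its section, and a scalar
    t(y, g).  Associativity gives t(y, g) t(y g, h) = theta(g, h) t(y, g h), and
    the product over y is the assertion, since y |-> y g permutes Y. *)
Lemma transfer (yT : finType) (to : {action hT &-> yT}) (Y : {set yT}) :
  [acts [set: hT], on Y | to] ->
  (forall y, y \in Y -> splits_on 'C[y | to]) -> trivial_power #|Y|.
Proof.
move=> aY spl; pose r y := odflt y [pick z in orbit to [set: hT]%G y].
have rO y : r y \in orbit to [set: hT]%G y.
  by rewrite /r; case: pickP => [z zO //|/(_ y)]; rewrite orbit_refl.
have rE y g : r (to y g) = r y.
  have e : orbit to [set: hT]%G y = orbit to [set: hT]%G (to y g).
    by apply/orbit_eqP; rewrite orbit_sym; apply: mem_orbit; rewrite inE.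
  by rewrite /r -e; case: pickP => // /(_ y); rewrite orbit_refl.
have rY y : y \in Y -> r y \in Y.
  move=> yY; have [g _ <-] := orbitP (rO y).
  by rewrite (acts_act aY) ?inE.
have [c cP] : {c : yT -> hT & forall y, to (r y) (c y) = y}.
  apply: (@choice _ _ (fun y g => to (r y) g = y)) => y.
  by have := rO y; rewrite orbit_sym => /orbitP [g _ gE]; exists g.
have [s sP] : {s : yT -> hT -> E & forall y, y \in Y ->
    {in 'C[y | to], forall h, pr (s y h) = h} /\
    {in 'C[y | to] &, {morph s y : h k / h * k}}}.
  apply: (@choice _ _ (fun y (s : hT -> E) => y \in Y ->
    {in 'C[y | to], forall h, pr (s h) = h} /\
    {in 'C[y | to] &, {morph s : h k / h * k}})) => y.
  by have [/spl [s sE]|_] := boolP (y \in Y); [exists s | exists (fun _ => 1)].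
pose l h : E := (1, h).
have lM g h : l g * l h = emb (theta g h) * l (g * h).
  by congr (_, _) => /=; rewrite ?mul1g // !coc2_1l !mulg1.
pose a y g := c y * g * (c (to y g))^-1.
have aS y g : a y g \in 'C[r y | to].
  by apply/astab1P; rewrite !actM cP -{1}(cP (to y g)) rE actK.
have [t tP] : {t : yT * hT -> U1 R & forall yg, yg.1 \in Y ->
    l (c yg.1) * l yg.2 = emb (t yg) * (s (r yg.1) (a yg.1 yg.2) * l (c (to yg.1 yg.2)))}.
  apply: (@choice _ _ (fun yg t => yg.1 \in Y -> l (c yg.1) * l yg.2 =
    emb t * (s (r yg.1) (a yg.1 yg.2) * l (c (to yg.1 yg.2))))) => -[y g] /=.
  have [yY|_] := boolP (y \in Y); last by exists 1.
  have [|u uE] := @same_fibre (l (c y) * l g) (s (r y) (a y g) * l (c (to y g))).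
    rewrite !prM (sP _ (rY y yY)).1 //.
    by change (c y * g = a y g * c (to y g)); rewrite /a mulgVK.
  by exists u.
have tM y g h : y \in Y -> t (y, g) * t (to y g, h) = theta g h * t (y, g * h).
  move=> yY; have ygY : to y g \in Y by rewrite (acts_act aY) ?inE.
  have sM := (sP _ (rY y yY)).2.
  pose w := s (r y) (a y (g * h)) * l (c (to y (g * h))).
  apply: emb_inj; apply: (mulIg w).
  transitivity (l (c y) * l g * l h).
    rewrite (tP (y, g) yY) /= -!mulgA (tP (to y g, h) ygY) /= rE.
    rewrite embM (mulgA (s _ _)) -(embC _ (s _ _)) -!mulgA /w (mulgA (s _ _)) -sM ?aS //.
      by rewrite actM /a actM !mulgA mulgVK.
    by rewrite -(rE y g) aS.
  by rewrite -mulgA lM mulgA -embC -mulgA (tP (y, g * h) yY) /w mulgA embM.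
exists (fun g => \big[@u1mul R/1]_(y in Y) t (y, g)) => g h.
have -> : \big[@u1mul R/1]_(y in Y) t (y, h) = \big[@u1mul R/1]_(y in Y) t (to y g, h).
  rewrite (reindex_inj (act_inj to g)); apply: eq_bigl => y.
  by rewrite (acts_act aY) ?inE.
rewrite -[LHS]/(u1mul _ _) -big_split /=.
rewrite (eq_bigr (fun y => u1mul (theta g h) (t (y, g * h)))); last first.
  by move=> y yY; exact: tM.
by rewrite big_split /= big_u1_const.
Qed.

Lemma acts_of_stable (yT : finType) (to : {action hT &-> yT}) (Y : {set yT}) :
  (forall y g, y \in Y -> to y g \in Y) -> [acts [set: hT], on Y | to].
Proof.
move=> st; apply/actsP => g _ y; apply/idP/idP => [|/st //].
by move=> /(st _ g^-1); rewrite actK.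
Qed.

(** The hypotheses are what is needed of the multiplicative group of quaternions:
    Z plays the part of {1, -1}.  The transfer is applied to the cosets of Z under
    translation (Y2) and to the nontrivial cosets under conjugation (Y1). *)
Lemma coboundary_of_involutions (Z := [set z : hT | z * z == 1]) :
  (forall z h, z \in Z -> z * h = h * z) ->
  (forall z w, z \in Z -> w \in Z -> z != 1 -> w != 1 -> z = w) ->
  (forall x, x \notin Z -> cyclic 'C[x]) ->
  (forall x j z, x \notin Z -> z \in Z -> z != 1 -> x ^ j = z * x ->
     {in 'C[x], forall a, a ^ j = a^-1}) ->
  exists B : hT -> U1 R, forall h k, B h * B k = theta h k * B (h * k).
Proof.
move=> Zc Z2 Ccyc Cinv.
have fixC (x h : hT) : x ^ h = x -> h \in 'C[x].
  by move=> e; apply/cent1P; rewrite /commute [x * h]conjgC e.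
have gZ : group_set Z.
  apply/group_setP; split=> [|z w zZ wZ]; first by rewrite inE mulg1.
  have := zZ; have := wZ; rewrite !inE => /eqP ww /eqP zz.
  by rewrite -mulgA (mulgA w) (Zc _ _ wZ) mulgA mulgA -mulgA ww mulg1 zz.
pose ZG := Group gZ; pose P x := ZG :* x.
have PE x y : P x = P y <-> exists2 z, z \in Z & x = z * y.
  split=> [/rcoset_eqP/rcosetP [z zZ ->]|[z zZ ->]]; first by exists z.
  by apply/rcoset_eqP/rcosetP; exists z.
have PJ x h : P x :^ h = P (x ^ h).
  rewrite /P conjsMg conjg_set1; congr (_ * _)%g.
  apply/setP => z; rewrite mem_conjg.
  have ZJ w k : w \in Z -> w ^ k = w by move=> wZ; rewrite conjgE (Zc _ _ wZ) mulKg.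
  apply/idP/idP => [zZ|/[dup] zZ /ZJ ->//].
  by rewrite -(conjgKV h z) (ZJ _ h zZ).
pose Y2 : {set {set hT}} := [set P x | x in [set: hT]].
pose Y1 := Y2 :\ P 1.
have YP x : P x \in Y2 by apply: imset_f; rewrite inE.
have [|_ /imsetP [x _ ->]|B2 B2M] := @transfer _ 'Rs%act Y2.
- apply: acts_of_stable => _ g /imsetP [x _ ->] /=.
  by rewrite rcosetE -rcosetM YP.
- have : exists z, Z \subset <[z]>.
    have [/existsP [z /andP [zZ z1]]|no] := boolP [exists z, (z \in Z) && (z != 1)].
      exists z; apply/fintype.subsetP => w wZ; have [->|w1] := eqVneq w 1.
        exact: group1.
      by rewrite (Z2 _ _ wZ zZ w1 z1) cycle_id.
    exists 1; apply/fintype.subsetP => w wZ; have [->|w1] := eqVneq w 1.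
      exact: group1.
    by case/negP: no; apply/existsP; exists w; rewrite wZ.
  case=> z Zz; apply: splits_onS (splits_cyclic (cycle_cyclic z)).
  apply: fintype.subset_trans Zz; apply/fintype.subsetP => h /astab1P /=.
  rewrite rcosetE -rcosetM => /PE [w wZ] e.
  have <- : w = h; last by [].
  by apply: (mulgI x); rewrite e (Zc _ _ wZ).
have [|y|B1 B1M] := @transfer _ 'Js%act Y1.
- apply: acts_of_stable => y g /setD1P [y1 /imsetP [x _ yE]] /=.
  rewrite {}yE in y1 *; rewrite PJ; apply/setD1P; split=> //.
  apply: contra_neq y1 => e; apply: (@conjsg_inj _ g).
  by rewrite !PJ e conj1g.
- case/setD1P => y1 /imsetP [x _ yE]; rewrite {}yE in y1 *.
  have xZ : x \notin Z.
    by apply: contra_neqN y1 => xZ; apply/PE; exists x; rewrite ?mulg1.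
  have SE h : h \in 'C[P x | 'Js] -> exists2 z, z \in Z & x ^ h = z * x.
    by move=> /astab1P /=; rewrite PJ => /PE.
  have [sub|] := boolP ('C[P x | 'Js] \subset 'C[x]).
    exact: splits_onS sub (splits_cyclic (Ccyc _ xZ)).
  case/subsetPn => j jS jC; have [z zZ jE] := SE j jS.
  have z1 : z != 1.
    by apply: contra jC => /eqP z1; apply: fixC; rewrite jE z1 mul1g.
  apply: (@splits_quaternion 'C[x]%G j) => //.
  - exact: Ccyc.
  - exact: Cinv jE.
  - apply: fixC; rewrite conjgM jE conjMg jE.
    rewrite conjgE (Zc _ j zZ) mulKg mulgA.
    by move: zZ; rewrite inE => /eqP ->; rewrite mul1g.
  - apply: contra jC => jj; apply/cent1P.
    by apply: Zc; rewrite inE.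
  - move=> h /SE [w wZ hE].
    have [w1|w1] := eqVneq w 1.
      by left; apply: fixC; rewrite hE w1 mul1g.
    right; apply: fixC.
    by rewrite conjgM hE (Z2 _ _ wZ zZ w1 z1) -jE conjgK.
have nE : #|Y2| = #|Y1|.+1 by rewrite (cardsD1 (P 1)) YP.
exists (fun h => B2 h * (B1 h)^-1) => h k.
apply: val_inj => /=.
have /(congr1 val) /= e1 := B1M h k; have /(congr1 val) /= e2 := B2M h k.
rewrite u1X in e1; rewrite u1X nE exprS in e2.
have n1 := u1_neq0 (B1 h); have n2 := u1_neq0 (B1 k); have n3 := u1_neq0 (B1 (h * k)).
have n4 : (u1val (theta h k) ^+ #|Y1|)%R != 0%R by rewrite expf_neq0 ?u1_neq0.
transitivity ((u1val (B2 h) * u1val (B2 k)) / (u1val (B1 h) * u1val (B1 k)))%R.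
  by field; rewrite n1 n2.
rewrite e1 e2; move: (_ ^+ _)%R n4 => t n4.
by field; rewrite n3 n4.
Qed.
End Splitting.

(** * Cocycles on finite groups of unit quaternions *)

Section QuaternionGroups.
Context (R : realType).
Local Open Scope ring_scope.
Implicit Types x y : quat R.

Definition qim2 x : R := let: (_, b, c, d) := x in b ^+ 2 + c ^+ 2 + d ^+ 2.

Lemma qim2_eq0 x : qim2 x = 0 -> x = (x.1.1.1, 0, 0, 0).
Proof.
case: x => [[[a b] c] d] /= /eqP.
rewrite !paddr_eq0 ?addr_ge0 ?sqr_ge0 // !sqrf_eq0.
by move=> /andP[/andP[/eqP-> /eqP->] /eqP->].
Qed.

Lemma qsqr1 x : qnorm2 x = 1 -> qmul x x = qone R <-> qim2 x = 0.
Proof.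
case: x => [[[a b] c] d] nx; split=> [[e _ _ _]|e]; first by move: nx e => /=; lra.
case: (qim2_eq0 e) => b0 c0 d0; subst b c d; move: nx => /= nx.
by rewrite /qone; congr (_, _, _, _); lra.
Qed.

Lemma qim2_comm x y : qim2 x = 0 -> qmul x y = qmul y x.
Proof.
move=> /qim2_eq0 ->; case: y => [[[a b] c] d] /=.
by congr (_, _, _, _); ring.
Qed.

Lemma qim2_pm1 x : qnorm2 x = 1 -> qim2 x = 0 -> x = qone R \/ x = (-1, 0, 0, 0).
Proof.
move=> nx /qim2_eq0 xE; rewrite {}xE in nx *; move: nx => /=.
have -> : x.1.1.1 ^+ 2 + 0 ^+ 2 + 0 ^+ 2 + 0 ^+ 2 = x.1.1.1 ^+ 2 by ring.
by move/eqP; rewrite sqrf_eq1 => /orP[] /eqP ->; [left | right].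
Qed.

Lemma qcomm_cross x y : qmul x y = qmul y x ->
  let: (_, b, c, d) := x in let: (_, b', c', d') := y in
  [/\ c * d' = d * c', d * b' = b * d' & b * c' = c * b'].
Proof.
case: x y => [[[a b] c] d] [[[a' b'] c'] d'] /= [e1 e2 e3].
by split; lra.
Qed.

(** If j conjugates x to -x, then x and j are orthogonal imaginary quaternions.
    What commutes with x lies in the plane spanned by 1 and x, on which
    conjugation by the unit imaginary j is quaternionic conjugation. *)
Lemma anticomm_inverts x j y : qnorm2 x = 1 -> qnorm2 j = 1 ->
  qmul x j = qmul (qmul (-1, 0, 0, 0) j) x ->
  qmul x y = qmul y x -> qmul y j = qmul j (qconj y).
Proof.
move=> nx nj anti /qcomm_cross; move: nx nj anti.
case: x j y => [[[a b] c] d] [[[p q] r] s] [[[k l] m] n] /= nx nj [e0 e1 e2 e3].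
move=> [f1 f2 f3].
have g0 : a * p = b * q + c * r + d * s by lra.
have g1 : a * q = - (p * b) by lra.
have g2 : a * r = - (p * c) by lra.
have g3 : a * s = - (p * d) by lra.
have p0 : p = 0.
  have : p * (a ^+ 2 + b ^+ 2 + c ^+ 2 + d ^+ 2) = 0.
    have -> : p * (a ^+ 2 + b ^+ 2 + c ^+ 2 + d ^+ 2) =
      a * (a * p) + b * (p * b) + c * (p * c) + d * (p * d) by ring.
    have -> : p * b = - (a * q) by lra.
    have -> : p * c = - (a * r) by lra.
    have -> : p * d = - (a * s) by lra.
    by rewrite g0; ring.
  by rewrite nx mulr1.
subst p; rewrite !mul0r oppr0 in g1 g2 g3; rewrite mulr0 in g0.
have a0 : a = 0.
  apply/eqP; have /eqP : a * (q ^+ 2 + r ^+ 2 + s ^+ 2) = 0.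
    have -> : a * (q ^+ 2 + r ^+ 2 + s ^+ 2) =
      q * (a * q) + r * (a * r) + s * (a * s) by ring.
    by rewrite g1 g2 g3; ring.
  have -> : q ^+ 2 + r ^+ 2 + s ^+ 2 = 1 by lra.
  by rewrite mulr1.
have dot : l * q + m * r + n * s = 0.
  (* (u.w)(v.v) = (u.v)(v.w) + (u x v).(w x v), and u x v = 0 *)
  transitivity ((l * q + m * r + n * s) * (a ^+ 2 + b ^+ 2 + c ^+ 2 + d ^+ 2)).
    by rewrite nx mulr1.
  transitivity ((l * b + m * c + n * d) * (b * q + c * r + d * s)
    + a ^+ 2 * (l * q + m * r + n * s)
    + (q * c - r * b) * (l * c - m * b) + (r * d - s * c) * (m * d - n * c)
    + (s * b - q * d) * (n * b - l * d)); first by ring.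
  have h1 : l * c - m * b = 0 by lra.
  have h2 : m * d - n * c = 0 by lra.
  have h3 : n * b - l * d = 0 by lra.
  by rewrite -g0 a0 h1 h2 h3; ring.
by congr (_, _, _, _); lra.
Qed.

Definition qdot x y : R :=
  let: (_, b, c, d) := x in let: (_, b', c', d') := y in b * b' + c * c' + d * d'.

(** The coordinate of y in the plane spanned by 1 and x, identified with the
    complex numbers, when y commutes with x; multiplicative on such y only. *)
Definition qline x y : R[i] :=
  let: (a, _, _, _) := y in Complex a (qdot x y / Num.sqrt (qim2 x)).

Lemma qim2_ge0 x : 0 <= qim2 x.
Proof. by case: x => [[[a b] c] d] /=; rewrite !addr_ge0 ?sqr_ge0. Qed.

Lemma qlineM x y z : qim2 x != 0 -> qmul y x = qmul x y -> qmul z x = qmul x z ->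
  qline x (qmul y z) = qline x y * qline x z.
Proof.
move=> x0 /qcomm_cross + /qcomm_cross.
have : Num.sqrt (qim2 x) * Num.sqrt (qim2 x) = qim2 x.
  by rewrite -expr2 sqr_sqrtr ?qim2_ge0.
have : Num.sqrt (qim2 x) != 0.
  by rewrite sqrtr_eq0 -ltNge lt_def x0 qim2_ge0.
rewrite /qline; move: {x0} (Num.sqrt _ : R) => r r0.
case: x y z => [[[a b] c] d] [[[a1 b1] c1] d1] [[[a2 b2] c2] d2] /=.
move=> rr [e1 e2 e3] [f1 f2 f3].
have -> : Complex a1 ((b * b1 + c * c1 + d * d1) / r) *
    Complex a2 ((b * b2 + c * c2 + d * d2) / r) =
  Complex (a1 * a2 - ((b * b1 + c * c1 + d * d1) / r) * ((b * b2 + c * c2 + d * d2) / r))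
    (a1 * ((b * b2 + c * c2 + d * d2) / r) + ((b * b1 + c * c1 + d * d1) / r) * a2) by [].
have h1 : b1 * c = c1 * b by lra.
have h2 : c1 * d = d1 * c by lra.
have h3 : d1 * b = b1 * d by lra.
congr Complex.
  have -> : (b * b1 + c * c1 + d * d1) / r * ((b * b2 + c * c2 + d * d2) / r) =
    b1 * b2 + c1 * c2 + d1 * d2; last by ring.
  have -> : (b * b1 + c * c1 + d * d1) / r * ((b * b2 + c * c2 + d * d2) / r) =
    ((b * b1 + c * c1 + d * d1) * (b * b2 + c * c2 + d * d2)) / (r * r) by field.
  apply: (mulIf (mulf_neq0 r0 r0)); rewrite mulfVK ?mulf_neq0 // rr.
  (* (v.u)(v.w) = (u.w)(v.v) - (u x v).(w x v), and u x v = 0 *)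
  transitivity ((b1 * b2 + c1 * c2 + d1 * d2) * (b ^+ 2 + c ^+ 2 + d ^+ 2)
    - ((b1 * c - c1 * b) * (b2 * c - c2 * b) + (c1 * d - d1 * c) * (c2 * d - d2 * c)
       + (d1 * b - b1 * d) * (d2 * b - b2 * d))); first by ring.
  by rewrite h1 h2 h3; ring.
transitivity ((a1 * (b * b2 + c * c2 + d * d2) + (b * b1 + c * c1 + d * d1) * a2
  + (b2 * (c * d1 - d * c1) + c2 * (d * b1 - b * d1) + d2 * (b * c1 - c * b1))) / r).
  by congr (_ / _); ring.
have -> : c * d1 - d * c1 = 0 by lra.
have -> : d * b1 - b * d1 = 0 by lra.
have -> : b * c1 - c * b1 = 0 by lra.
by field.
Qed.

Lemma qline1 x y : qnorm2 y = 1 -> qline x y = 1 <-> y = qone R.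
Proof.
case: x y => [[[a b] c] d] [[[a1 b1] c1] d1] /= ny; split=> [|[-> -> -> ->]]; last first.
  by rewrite !mulr0 !addr0 mul0r.
case=> a1E _; have /qim2_eq0 /= [-> -> ->] : qim2 (a1, b1, c1, d1) = 0.
  by move: ny; rewrite /= a1E; lra.
by rewrite a1E.
Qed.

(** The involutions of H and 1 are its real elements.  The centraliser of any
    other element embeds into the multiplicative group of a field by [qline],
    so it is cyclic. *)
Lemma coboundary_uquat (hT : finGroupType) (theta : cocycle2 R (disc hT))
    (iota : hT -> uquat R) : injective iota ->
    {morph iota : h k / (h * k)%g} ->
  exists B : hT -> U1 R, forall h k, (B h * B k = theta h k * B (h * k))%g.
Proof.
move=> inj iM; have nq h : qnorm2 (iota h) = 1 by exact/eqP/uqP.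
have i1 : iota 1%g = 1%g.
  by apply: (mulgI (iota 1%g)); rewrite -iM !mulg1.
have qM h k : uqval (iota (h * k)%g) = qmul (iota h) (iota k) by rewrite iM.
have injq h k : uqval (iota h) = iota k -> h = k by move=> /val_inj /inj.
have ZE h : (h \in [set z : hT | (z * z == 1)%g]) = (qim2 (iota h) == 0).
  rewrite inE; apply/eqP/eqP => [e|/(qsqr1 (nq h)) e].
    by apply/(qsqr1 (nq h)); rewrite -qM e i1.
  by apply: (injq _ _); rewrite qM i1.
apply: coboundary_of_involutions => [z h|z w|x|x j z].
- by rewrite ZE => /eqP z0; apply: (injq _ _); rewrite !qM (qim2_comm _ z0).
- rewrite !ZE => /eqP z0 /eqP w0 z1 w1; apply: (injq _ _).
  have [zE|->] := qim2_pm1 (nq z) z0.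
    by move/eqP: z1; case; apply: (injq _ _); rewrite i1.
  have [wE|->//] := qim2_pm1 (nq w) w0.
  by move/eqP: w1; case; apply: (injq _ _); rewrite i1.
- rewrite ZE => x0.
  have cx h : h \in 'C[x]%g -> qmul (iota h) (iota x) = qmul (iota x) (iota h).
    by move=> /cent1P xh; rewrite -!qM xh.
  apply: (@field_mul_group_cyclic _ 'C[x]%G _ (fun h => qline (iota x) (iota h))).
    by move=> h k /cx hx /cx kx; rewrite qM qlineM.
  move=> h _; split=> [/(qline1 _ (nq h)) e|->].
    by apply: (injq _ _); rewrite e i1.
  by rewrite i1; apply/(qline1 _ (qnorm21 R)).
- rewrite !ZE => x0 /eqP z0 z1 xj a /cent1P ax; apply: (injq _ _).
  have [zE|zE] := qim2_pm1 (nq z) z0.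
    by move/eqP: z1; case; apply: (injq _ _); rewrite i1.
  have aV : uqval (iota a^-1)%g = qconj (iota a).
    suff -> : (iota a^-1 = (iota a)^-1)%g by [].
    by apply: (mulgI (iota a)); rewrite -iM !mulgV.
  have e : (x * j = z * j * x)%g.
    rewrite conjgC xj mulgA; congr (_ * _)%g.
    by apply: (injq _ _); rewrite !qM (qim2_comm _ z0).
  have e2 : qmul (iota a) (iota j) = qmul (iota j) (iota a^-1)%g.
    rewrite aV; apply: (anticomm_inverts (nq x) (nq j)).
      by rewrite -zE -!qM e.
    by rewrite -!qM ax.
  congr uqval; congr iota; rewrite conjgE.
  by apply: (mulgI j); rewrite mulKVg; apply: (injq _ _); rewrite !qM.
Qed.
End QuaternionGroups.

Local Open Scope classical_set_scope.
Local Open Scope ring_scope.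

(** * Characters of the line and scalar multiplication on bundles *)

Section Circle.
Context (R : realType).

Lemma realC_continuous : continuous (fun x : R => (x%:C)%C : CC R).
Proof.
move=> a; apply/cvgrPdist_lt => -[e f]; rewrite ltcE /= => /andP[/eqP f0 e0].
subst f; near=> t; rewrite -raddfB normc_def /= expr0n /= addr0 sqrtr_sqr ltcR.
by near: t; exact: cvgr_dist_lt.
Unshelve. all: by end_near.
Qed.

Lemma expi_subproof (t : R) : `|Complex (cos t) (sin t) : CC R| == 1.
Proof. by rewrite normc_def /= cos2Dsin2 sqrtr1. Qed.

Definition expi (t : R) : U1 R := MkU1 (expi_subproof t).

Lemma expiD s t : expi (s + t) = (expi s * expi t)%g.
Proof.
apply: val_inj; rewrite /= cosD sinD.
by congr Complex; rewrite addrC.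
Qed.

Lemma expi_surj (u : U1 R) : exists t, expi t = u.
Proof.
case: u => -[a b] u1.
have ab : a ^+ 2 + b ^+ 2 = 1.
  have := eqP u1; rewrite normc_def /= => /(congr1 (@complex.Re R)) /= e.
  by rewrite -[LHS]sqr_sqrtr ?e ?expr1n // addr_ge0 ?sqr_ge0.
have b2 : 0 <= b ^+ 2 by exact: sqr_ge0.
have a1 : -1 <= a <= 1 by apply/andP; split; nra.
have cE : cos (acos a) = a by exact: (acos_def a1).2.
have sE : sin (acos a) = `|b|.
  by rewrite sin_acos // -ab addrAC subrr add0r sqrtr_sqr.
have [b0|b0] := leP 0 b.
  by exists (acos a); apply: val_inj; rewrite /= cE sE ger0_norm.
exists (- acos a); apply: val_inj; rewrite /= cosN sinN cE sE.
by rewrite ltr0_norm ?opprK.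
Qed.

Lemma expi_continuous : continuous (expi : R -> U1 R).
Proof.
apply: continuous_to_initial => t /=.
have -> : @u1val R \o expi =
   (fun x => (((cos x)%:C)%C : CC R) + ('i%C : CC R) * (((sin x)%:C)%C : CC R)).
  by apply/funext => x /=; rewrite /real_complex_def; congr Complex; rewrite /=; ring.
apply: cvgD.
  exact: (continuous_compose (@continuous_cos R) realC_continuous).
apply: cvgMr.
exact: (continuous_compose (@continuous_sin R) realC_continuous).
Qed.

Lemma Rchar_exists (u : U1 R) : exists e : R -> U1 R,
  [/\ continuous e, {morph e : s t / s + t >-> (s * t)%g} & e (-1) = u].
Proof.
have [b <-] := expi_surj u.
exists (fun t => expi (- b * t)); split.
- move=> t; apply: (@continuous_comp _ _ _ (fun t => - b * t) expi).
    by apply: cvgMr; exact: cvg_id.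
  exact: expi_continuous.
- by move=> s t; rewrite mulrDr expiD.
- by congr expi; ring.
Qed.

End Circle.

Section Scaling.
Context (R : realType) (Y : topologicalType).

Definition vscale (E : vfamily R Y) (z : CC R) (e : vtot E) : vtot E :=
  VPoint (vbase e) (z *: vvec e).

Lemma vscale1 (E : vfamily R Y) (e : vtot E) : vscale 1 e = e.
Proof. by case: e => y v; rewrite /vscale scale1r. Qed.

Lemma vscaleM (E : vfamily R Y) (z w : CC R) (e : vtot E) :
  vscale (z * w) e = vscale z (vscale w e).
Proof. by rewrite /vscale /= scalerA. Qed.

(** In a chart scalar multiplication becomes that of C^n. *)
Lemma vscale_continuous (E : vfamily R Y) : is_vbundle E ->
  continuous (fun ze : CC R * vtot E => vscale ze.1 ze.2).
Proof.
move=> [cp lt] [z0 e0].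
have [U [oU Uy [n [phi [psi [c1 c2 c3 c4 c5]]]]]] := lt (vproj e0).
have oU' : open (@vproj R Y E @^-1` U) by exact: open_comp (fun e _ => cp e) oU.
have phiZ z (e : vtot E) : U (vproj e) -> phi (vscale z e) = z *: phi e.
  case: e => y v Uy'; have lin := c3 y Uy'.
  have phi0 : phi (@vpt R Y E y 0) = 0.
    have := lin 1 0 0; rewrite !scale1r addr0 => /eqP.
    by rewrite -subr_eq subrr => /eqP <-.
  by have := lin z v 0; rewrite /= phi0 !addr0.
have E1 (ze : CC R * vtot E) : U (vproj ze.2) ->
    vscale ze.1 ze.2 = psi (vproj ze.2, ze.1 *: phi ze.2).
  case: ze => z e /= Ue; rewrite -phiZ // -[in LHS](c5 (vscale z e)) //.
have nU : nbhs (z0, e0) [set ze : CC R * vtot E | U (vproj ze.2)].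
  apply: open_nbhs_nbhs; split => //.
  have cs : continuous (fun ze : CC R * vtot E => vproj ze.2).
    exact: (continuous_compose (@continuous_snd _ _) cp).
  exact: (open_comp (fun ze _ => cs ze) oU).
have cs : continuous (fun ze : CC R * vtot E => vproj ze.2).
  exact: (continuous_compose (@continuous_snd _ _) cp).
have h1 := cs (z0, e0).
have cphi : {for e0, continuous phi}.
  by move: c1; rewrite continuous_open_subspace //; apply; apply/mem_set.
have h3 := @continuous_comp _ _ _ (snd : CC R * vtot E -> vtot E) phi (z0, e0)
  (@continuous_snd _ _ _) cphi.
have h2 : (fun ze : CC R * vtot E => ze.1 *: phi ze.2) @ (z0, e0)
    --> (z0 *: phi e0 : 'rV[CC R]_n).
  by apply: cvgZ; [exact: cvg_fst | exact: h3].
have cg := cvg_pair h1 h2 (FF := nbhs_filter _) (FG := nbhs_filter _)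
  (FH := nbhs_filter _).
have cpsi : {for (vproj e0, z0 *: phi e0), continuous psi}.
  move: c2; rewrite continuous_open_subspace; last first.
    have -> : U `*` [set: 'rV[CC R]_n] = fst @^-1` U.
      by apply/seteqP; split=> -[? ?] //= [].
    by apply: open_comp oU => ? _; exact: continuous_fst.
  by apply; apply/mem_set; split.
rewrite /continuous_at [X in _ --> X]E1 //.
apply: (cvg_trans (near_eq_cvg (f := fun ze : CC R * vtot E =>
  psi (vproj ze.2, ze.1 *: phi ze.2)) _)).
  by apply: filterS nU => ze Uze; exact/esym/E1.
exact: (@cvg_comp _ _ _ _ psi _ _ _ cg cpsi).
Qed.
End Scaling.

(** * Rescaling the action on an equivariant bundle *)

Section Fibre.
Context (F : nmodType) (Y : Type) (rk : Y -> nat).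

(** The action of an equivariant bundle takes values in fibres over points that
    are only provably equal to the expected ones; this reads a point of the total
    space as a vector in the fibre over y, with value 0 when it is not there. *)
Definition at_fibre (y : Y) (e : vpoint F rk) : 'rV[F]_(rk y) :=
  match pselect (vbase e = y) with
  | left eq => eq_rect _ (fun z => 'rV[F]_(rk z)) (vvec e) _ eq
  | right _ => 0
  end.

Lemma at_fibreK y e : vbase e = y -> VPoint y (at_fibre y e) = e.
Proof.
move=> <-; rewrite /at_fibre; case: pselect => // eq.
by rewrite (Prop_irrelevance eq erefl); case: (e).
Qed.

Lemma at_fibre_point y v : at_fibre y (VPoint y v) = v.
Proof.
rewrite /at_fibre; case: pselect => // eq.
by rewrite (Prop_irrelevance eq erefl).
Qed.

Lemma VPoint_inj y : injective (fun v => VPoint y v : vpoint F rk).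
Proof. by move=> v w e; rewrite -(at_fibre_point v) [VPoint y v]e at_fibre_point. Qed.
End Fibre.

Lemma linear_ext (F : pzRingType) (U V : lmodType F) (f g : {linear U -> V}) :
  f =1 g -> f = g.
Proof.
case: f g => f [[a] [b]] [g [[a'] [b']]] /= /funext fg; subst g.
by rewrite (Prop_irrelevance a a') (Prop_irrelevance b b').
Qed.

Section Ext.
Context (R : realType) (P : tgroupType) (W : set (P * CC R)) (Y : gspace P).

(** Bundles with the same ranks, the same open sets and the same action on the
    total space are equal.  The proofs in the two families are allowed to differ
    because slicing a rescaled bundle and rescaling a sliced one produce families
    that agree only up to these proofs. *)
Lemma EqBundle_eq rk op t i u t' i' u'
    (E := @VFamily R Y rk op t i u) (F := @VFamily R Y rk op t' i' u') b b' a a'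
    e1 e2 e3 e4 f1 f2 f3 f4 :
  (forall p (e : vpoint (CC R) rk), tot_action (E := E) a p e =
     tot_action (E := F) a' p e :> vpoint (CC R) rk) ->
  @EqBundle R P W Y E b a e1 e2 e3 e4 = @EqBundle R P W Y F b' a' f1 f2 f3 f4.
Proof.
rewrite {}/F in b' a' f1 f2 f3 f4 *; rewrite -(Prop_irrelevance t t').
move: b' a' f1 f2 f3 f4; rewrite -(Prop_irrelevance t t') -(Prop_irrelevance i i').
rewrite -(Prop_irrelevance u u') -/E => b' a' f1 f2 f3 f4 aa.
have e : a = a'.
  apply: functional_extensionality_dep => p.
  apply: functional_extensionality_dep => y.
  by apply: linear_ext => v; exact: VPoint_inj (aa p (VPoint y v)).
subst a'; rewrite (Prop_irrelevance b b') (Prop_irrelevance e1 f1).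
rewrite (Prop_irrelevance e2 f2) (Prop_irrelevance e3 f3).
by rewrite (Prop_irrelevance e4 f4).
Qed.
End Ext.

Section Quotient.
Context (K : tgroupType) (c : central K).
Hypothesis trans : forall x : K, continuous (fun y => (x * y)%g).

(** The saturation of an open set is the union of its translates by the powers of
    the central element. *)
Lemma cproj_open (U : set K) : open U -> open (cproj c @` U).
Proof.
move=> oU; rewrite /open /= /quotient_open.
pose V (x : K) := (fun y => (x * y)%g) @^-1` U.
have oV x : open (V x) by exact: open_comp (fun y _ => @trans x y) oU.
have -> : (cproj c : K -> cquot c) @^-1` (cproj c @` U) =
    \bigcup_(n : nat) (V (celt c ^+ n)%g `|` V (celt c ^- n)%g).
  apply/seteqP; split=> y /=.
    case=> x Ux /esym/cprojP [n xy]; exists n => //=.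
    have xE : x = (y * (y^-1 * x))%g by rewrite mulgA mulgV mul1g.
    have cyc : in_cycle (celt c) (y^-1 * x)%g by exists n.
    by case: xy => e; [left | right]; rewrite /V /= -e (in_cycleC y cyc) -xE.
  case=> n _ /= [] h; (eexists; first exact: h); apply/cprojP.
    have cyc : in_cycle (celt c) (celt c ^+ n)%g by exists n; left.
    by rewrite (in_cycleC y cyc) invMg mulgVK; exact: (in_cycleV cyc).
  have cyc : in_cycle (celt c) (celt c ^- n)%g by exists n; right.
  by rewrite (in_cycleC y cyc) invMg mulgVK; exact: (in_cycleV cyc).
by apply: bigcup_open => n _; exact: openU.
Qed.

(** The product of a quotient map with an identity map need not be a quotient
    map; it is one here because the projection is open. *)
Lemma cquot_continuous (A B : topologicalType) (f : cquot c * A -> B) :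
  continuous (fun xa : K * A => f (cproj c xa.1, xa.2)) -> continuous f.
Proof.
move=> cf [q a] D; rewrite -(creprK q) => nD.
have [[U V] /= [nU nV] UV] := cf (crepr q, a) D nD.
exists (cproj c @` U, V) => /=.
  split=> //; move: nU; rewrite nbhsE => -[U0 [oU0 U0q] U0U].
  apply: (filterS (P := cproj c @` U0)); first exact: image_subset.
  by apply: open_nbhs_nbhs; split; [exact: cproj_open | exists (crepr q)].
move=> [_ b] [/= [x Ux <-] Vb]; exact: (UV (x, b)).
Qed.
End Quotient.

Section Rescale.
Context (R : realType) (K K' : tgroupType) (c : central K) (c' : central K').
Context (W : set (cquot c * CC R)) (W' : set (cquot c' * CC R)).
Context (rho : K' -> K) (psi : K' -> CC R).
Hypothesis trans : forall x : K', continuous (fun y => (x * y)%g).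
Hypothesis rho_cont : continuous rho.
Hypothesis psi_cont : continuous psi.
Local Notation bactE E := (@bact R _ _ _ E).

(** The action of K' on a bundle over K / c obtained by pulling back along rho and
    multiplying by psi.  Neither rho nor psi has to be multiplicative: in the
    passage from Lambda^alpha(g) to Lambda(g), rho is a set-theoretic section, and
    only the combination of the two is an action. *)
Definition rescaled (Y : gspace (cquot c)) (E : eqbundle W Y) (x : K')
    (e : vtot E) : vtot E :=
  vscale (psi x) (bactE E (cproj c (rho x)) e).

(** The conditions under which the rescaled action is one of K' / c', with the
    scalars prescribed by W'. *)
Record rescalable (Y : gspace (cquot c)) (E : eqbundle W Y) : Prop := Rescalable {
  resc1 : forall e, rescaled (E := E) 1%g e = e ;
  rescM : forall x y e,
    rescaled (E := E) (x * y)%g e = rescaled x (rescaled y e) ;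
  rescz : forall e, rescaled (E := E) (celt c') e = e ;
  rescW : forall p z, W' (p, z) -> exists2 x, p = cproj c' x &
    forall e, rescaled (E := E) x e = vscale z e
}.

Section OneSpace.
Context (Y : topologicalType) (a : cquot c -> Y -> Y) (a' : cquot c' -> Y -> Y).
Context (a1 : forall x, a 1%g x = x)
  (aM : forall p q x, a (p * q)%g x = a p (a q x))
  (ac : continuous (fun px : cquot c * Y => a px.1 px.2)).
Context (a1' : forall x, a' 1%g x = x)
  (aM' : forall p q x, a' (p * q)%g x = a' p (a' q x))
  (ac' : continuous (fun px : cquot c' * Y => a' px.1 px.2)).
Local Notation X := (GSpace a1 aM ac).
Local Notation X' := (GSpace a1' aM' ac').
Hypothesis compat : forall x y, a' (cproj c' x) y = a (cproj c (rho x)) y.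

Section OneBundle.
Context (E : eqbundle W X) (hE : rescalable E).

Lemma rescaled_cycle x e : in_cycle (celt c') x -> rescaled (E := E) x e = e.
Proof.
have pow n f : rescaled (E := E) (celt c' ^+ n)%g f = f.
  elim: n => [|n IH]; first by rewrite expg0 (resc1 hE).
  by rewrite expgS (rescM hE) IH (rescz hE).
case=> n [->|->]; first exact: pow.
by rewrite -[in LHS](pow n e) -(rescM hE) mulVg (resc1 hE).
Qed.

Definition resc_act (q : cquot c') (e : vtot E) : vtot E := rescaled (crepr q) e.

Lemma resc_actE x e : resc_act (cproj c' x) e = rescaled x e.
Proof.
have cyc := crepr_cproj c' x.
rewrite /resc_act; set r := crepr _ in cyc *.
have -> : r = (x * (x^-1 * r))%g by rewrite mulgA mulgV mul1g.
by rewrite (rescM hE) (rescaled_cycle e cyc).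
Qed.

Definition resc_fib (q : cquot c') (y : Y)
    (v : 'rV[CC R]_(vrk E y)) : 'rV[CC R]_(vrk E (a' q y)) :=
  at_fibre (a' q y) (resc_act q (@vpt _ _ E y v)).

Lemma resc_fib_linear q y : linear (@resc_fib q y).
Proof.
rewrite /resc_fib -(creprK q); move: (crepr q) => x k v w.
rewrite !resc_actE /rescaled /bact /tot_action /vscale /=.
move: (bfibact _ _ _) => l.
rewrite compat; rewrite !at_fibre_point.
by rewrite linearP scalerDr !scalerA mulrC.
Qed.
HB.instance Definition _ q y :=
  GRing.isLinear.Build (CC R) _ _ _ (@resc_fib q y) (@resc_fib_linear q y).

Definition resc_fibact : fib_action (Y := X') (bfam E) := fun q y => @resc_fib q y.

Lemma resc_totE q e : tot_action resc_fibact q e = resc_act q e.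
Proof.
have base : vbase (resc_act q e) = a' q (vbase e).
  by rewrite -(creprK q) resc_actE compat.
by case: e base => y v base; exact: (at_fibreK base).
Qed.

Let act1 e : tot_action resc_fibact 1%g e = e.
Proof. by rewrite resc_totE -cproj1 resc_actE (resc1 hE). Qed.
Let actM p q e :
  tot_action resc_fibact (p * q)%g e =
    tot_action resc_fibact p (tot_action resc_fibact q e).
Proof.
rewrite !resc_totE -(creprK p) -(creprK q) -cprojM !resc_actE.
exact: (rescM hE).
Qed.
Let act_cont :
  continuous (fun pe : cquot c' * vtot E => tot_action resc_fibact pe.1 pe.2).
Proof.
apply: (cquot_continuous trans).
have -> : (fun xa : K' * vtot E =>
      tot_action resc_fibact (cproj c' xa.1, xa.2).1 (cproj c' xa.1, xa.2).2) =
    (fun xa => rescaled xa.1 xa.2).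
  by apply/funext => -[x e]; rewrite /= resc_totE resc_actE.
apply: (continuous_compose (f := fun xe : K' * vtot E =>
  (psi xe.1, bactE E (cproj c (rho xe.1)) xe.2))
  (g := fun ze : CC R * vtot E => vscale ze.1 ze.2)).
  apply: continuous_pair.
    exact: (continuous_compose (@continuous_fst _ _) psi_cont).
  apply: (continuous_compose (f := fun xe : K' * vtot E => (cproj c (rho xe.1), xe.2))
    (g := fun pe : cquot c * vtot E => bactE E pe.1 pe.2)); last exact: bact_cont.
  apply: continuous_pair; last exact: continuous_snd.
  exact: (continuous_compose (continuous_compose (@continuous_fst K' (vtot E))
    rho_cont) (@cproj_continuous _ c)).
exact: (vscale_continuous (bfam_bundle E)).
Qed.
Let actW p z : W' (p, z) -> forall y (v : 'rV[CC R]_(vrk E y)),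
  tot_action resc_fibact p (VPoint y v) = VPoint y (z *: v).
Proof.
by move=> /(rescW hE) [x -> xz] y v; rewrite resc_totE resc_actE xz.
Qed.

Definition rescale : eqbundle W' X' :=
  @EqBundle R (cquot c') W' X' (bfam E) (bfam_bundle E) resc_fibact
    act1 actM act_cont actW.

Lemma bact_rescale x (e : vtot E) :
  bactE rescale (cproj c' x) e = rescaled (E := E) x e.
Proof. by rewrite -resc_actE -resc_totE. Qed.
End OneBundle.

Lemma rescale_dsum E E1 E2 (h : rescalable E) (h1 : rescalable E1)
    (h2 : rescalable E2) :
  is_dsum E E1 E2 -> is_dsum (rescale h) (rescale h1) (rescale h2).
Proof.
have bm (A B : eqbundle W X) (hA : rescalable A) (hB : rescalable B)
    (f : vmap A B) : is_bmap f -> is_bmap (f : vmap (rescale hA) (rescale hB)).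
  move=> [cf ef]; split=> // p e; rewrite -(creprK p) !bact_rescale.
  rewrite /rescaled -[in RHS]ef /vscale /vmap_tot /=; congr VPoint.
  by rewrite linearZ.
case=> f1 [f2 [m1 m2 b]]; exists f1, f2; split; [exact: bm|exact: bm|exact: b].
Qed.
End OneSpace.
End Rescale.

(** * Rescaling, slices and inverses *)

Section RescaleSlice.
Context (R : realType) (K K' : tgroupType) (c : central K) (c' : central K').
Context (W : set (cquot c * CC R)) (W' : set (cquot c' * CC R)).
Context (rho : K' -> K) (psi : K' -> CC R).
Hypothesis trans : forall x : K', continuous (fun y => (x * y)%g).
Hypothesis rho_cont : continuous rho.
Hypothesis psi_cont : continuous psi.
Context (Y : topologicalType) (a : cquot c -> Y -> Y) (a' : cquot c' -> Y -> Y).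
Context (a1 : forall x, a 1%g x = x)
  (aM : forall p q x, a (p * q)%g x = a p (a q x))
  (ac : continuous (fun px : cquot c * Y => a px.1 px.2)).
Context (a1' : forall x, a' 1%g x = x)
  (aM' : forall p q x, a' (p * q)%g x = a' p (a' q x))
  (ac' : continuous (fun px : cquot c' * Y => a' px.1 px.2)).
Local Notation X := (GSpace a1 aM ac).
Local Notation X' := (GSpace a1' aM' ac').
Hypothesis compat : forall x y, a' (cproj c' x) y = a (cproj c (rho x)) y.
Context (S : topologicalType) (s0 : S).

Lemma compat_prod x (ys : Y * S) :
  @Defs.gact _ (prod_gspace X' S) (cproj c' x) ys =
    @Defs.gact _ (prod_gspace X S) (cproj c (rho x)) ys.
Proof. by rewrite /= /prod_act /= compat. Qed.

Definition rescale_prod (E : eqbundle W (prod_gspace X S))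
    (hE : rescalable W' rho psi E) : eqbundle W' (prod_gspace X' S) :=
  @rescale R K K' c c' W W' rho psi trans rho_cont psi_cont (Y * S)%type _ _ _ _ _
    (@Defs.gact1 _ (prod_gspace X' S)) (@Defs.gactM _ (prod_gspace X' S))
    (@Defs.gact_cont _ (prod_gspace X' S)) compat_prod E hE.

(** Both sides have the fibres of E over the slice, and both actions are read off
    from the one on E. *)
Lemma slice_rescale (E : eqbundle W (prod_gspace X S))
    (hE : rescalable W' rho psi E)
    (hS : rescalable W' rho psi (slice s0 E)) :
  slice s0 (rescale_prod hE) =
  rescale trans rho_cont psi_cont a1' aM' ac' compat hS.
Proof.
apply: EqBundle_eq => p e.
rewrite -(creprK p); move: (crepr p) => x.
have e1 := bact_rescale trans rho_cont psi_cont (@Defs.gact1 _ (prod_gspace X' S))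
  (@Defs.gactM _ (prod_gspace X' S)) (@Defs.gact_cont _ (prod_gspace X' S)) compat_prod hE
  x (slice_in e).
have e2 := bact_rescale trans rho_cont psi_cont a1' aM' ac' compat hS x e.
refine (can_inj (@slice_inK R _ _ S s0 (rescale_prod hE)) _).
transitivity (rescaled (E := E) rho psi x (slice_in e)); first exact: e1.
exact: (esym (congr1 (fun e => slice_in e) e2)).
Qed.
End RescaleSlice.

Section RescaleK.
Context (R : realType) (K K' : tgroupType) (c : central K) (c' : central K').
Context (W : set (cquot c * CC R)) (W' : set (cquot c' * CC R)).
Context (rho : K' -> K) (psi : K' -> CC R) (rho' : K -> K') (psi' : K -> CC R).
Hypothesis trans : forall x : K', continuous (fun y => (x * y)%g).
Hypothesis trans' : forall x : K, continuous (fun y => (x * y)%g).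
Hypothesis rho_cont : continuous rho.
Hypothesis psi_cont : continuous psi.
Hypothesis rho_cont' : continuous rho'.
Hypothesis psi_cont' : continuous psi'.
Context (Y : topologicalType) (a : cquot c -> Y -> Y) (a' : cquot c' -> Y -> Y).
Context (a1 : forall x, a 1%g x = x)
  (aM : forall p q x, a (p * q)%g x = a p (a q x))
  (ac : continuous (fun px : cquot c * Y => a px.1 px.2)).
Context (a1' : forall x, a' 1%g x = x)
  (aM' : forall p q x, a' (p * q)%g x = a' p (a' q x))
  (ac' : continuous (fun px : cquot c' * Y => a' px.1 px.2)).
Local Notation X := (GSpace a1 aM ac).
Local Notation X' := (GSpace a1' aM' ac').
Hypothesis compat : forall x y, a' (cproj c' x) y = a (cproj c (rho x)) y.
Hypothesis compat' : forall x y, a (cproj c x) y = a' (cproj c' (rho' x)) y.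

(** The underlying family is untouched, so that going back and forth only has to
    restore the action. *)
Lemma rescaleK (E : eqbundle W X) (hE : rescalable W' rho psi E)
    (F := rescale trans rho_cont psi_cont a1' aM' ac' compat hE)
    (hF : rescalable W rho' psi' F) :
  (forall x (e : vtot E), vscale (psi' x) (vscale (psi (rho' x))
     (bact (cproj c (rho (rho' x))) e)) = bact (cproj c x) e) ->
  rescale trans' rho_cont' psi_cont' a1 aM ac compat' hF = E.
Proof.
move=> back.
have e1 x (e : vtot E) := bact_rescale trans rho_cont psi_cont a1' aM' ac' compat hE x e.
have e2 x (e : vtot F) := bact_rescale trans' rho_cont' psi_cont' a1 aM ac compat' hF x e.
have key p (e : vtot E) :
    @bact _ _ _ _ (rescale trans' rho_cont' psi_cont' a1 aM ac compat' hF) p e = bact p e.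
  rewrite -(creprK p) e2 -back; congr vscale; exact: e1.
move: key; rewrite {e1 e2}.
move: hF; rewrite {}/F; case: E hE {back} => -[rk op t i u] b l m1 m2 m3 m4 hE hF key.
by apply: EqBundle_eq => p e; exact: key.
Qed.
End RescaleK.

(** * Maps of K-groups induced by operations on bundles *)

(** Reduces the comparison of two additive maps to a comparison on bundles. *)
Lemma freeg_gen_ind (K : choiceType) (P : {freeg K / int} -> Prop) :
  P 0 -> (forall x y, P x -> P y -> P (x - y)) -> (forall k, P << k >>) ->
  forall x, P x.
Proof.
move=> P0 PB PU.
have PN x : P x -> P (- x) by rewrite -sub0r; exact: PB.
have PD x y : P x -> P y -> P (x + y).
  by move=> Px Py; rewrite -[y]opprK; exact: PB Px (PN _ Py).
have Pn n k : P (<< k >> *+ n) by elim: n => [|n IH]; rewrite ?mulr0n // mulrS; exact: PD.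
move=> x; rewrite -(freeg_sumE x); elim/big_rec: _ => // k y _ Py.
apply: PD => //; rewrite -[coeff k x]intz -freegU_mulz.
case: (coeff k x) => n; first exact: Pn.
by rewrite NegzE mulrNz; apply: PN; exact: Pn.
Qed.

Section FunctorK0.
Context (R : realType) (P P' : tgroupType) (W : set (P * CC R))
  (W' : set (P' * CC R)) (Y : gspace P) (Y' : gspace P').
Context (F : eqbundle W Y -> eqbundle W' Y').
Hypothesis F_dsum : forall E E1 E2, is_dsum E E1 E2 -> is_dsum (F E) (F E1) (F E2).

Definition free_map (x : {freeg (eqbundle W Y) / int}) :
    {freeg (eqbundle W' Y') / int} := fglift (fun E => << F E >>) x.

Lemma free_mapB x y : free_map (x - y) = free_map x - free_map y.
Proof. exact: lift_is_additive. Qed.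

Lemma free_map0 : free_map 0 = 0.
Proof. by rewrite -(subrr 0) free_mapB subrr. Qed.

Lemma free_mapU E : free_map << E >> = << F E >>.
Proof. by rewrite /free_map liftU scale1r. Qed.

Lemma free_map_null x : K0null x -> K0null (free_map x).
Proof.
elim=> [|{}x y _ hx _ hy|E E1 E2 h].
- by rewrite free_map0; exact: K0null0.
- by rewrite free_mapB; exact: K0nullB.
- by rewrite !free_mapB !free_mapU; apply: K0null_dsum; exact: F_dsum.
Qed.

Definition K0map (x : K0 W Y) : K0 W' Y' := K0pi (free_map (K0repr x)).

Lemma K0map_pi x : K0map (K0pi x) = K0pi (free_map x).
Proof.
apply/K0piP; rewrite -free_mapB; apply: free_map_null.
by apply/K0piP; rewrite K0reprK.
Qed.

Lemma K0mapB x y : K0map (x - y) = K0map x - K0map y.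
Proof.
rewrite -(K0reprK x) -(K0reprK y) -K0piB !K0map_pi -K0piB.
by rewrite free_mapB.
Qed.
End FunctorK0.

Lemma K0mapK (R : realType) (P P' : tgroupType) (W : set (P * CC R))
    (W' : set (P' * CC R)) (Y : gspace P) (Y' : gspace P')
    (F : eqbundle W Y -> eqbundle W' Y') (G : eqbundle W' Y' -> eqbundle W Y) :
  (forall E E1 E2, is_dsum E E1 E2 -> is_dsum (F E) (F E1) (F E2)) ->
  (forall E E1 E2, is_dsum E E1 E2 -> is_dsum (G E) (G E1) (G E2)) ->
  cancel F G -> cancel (K0map F) (K0map G).
Proof.
move=> dF dG FK x; rewrite -(K0reprK x) K0map_pi // K0map_pi //; congr K0pi.
elim/freeg_gen_ind: (K0repr x) => [|{}x y xK yK|E].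
- by rewrite !free_map0.
- by rewrite !free_mapB xK yK.
- by rewrite !free_mapU FK.
Qed.

Section KnegMap.
Context (R : realType) (P P' : tgroupType) (W : set (P * CC R))
  (W' : set (P' * CC R)) (Y : gspace P) (Y' : gspace P') (n : nat).
Local Notation Sn := (sphere R n).
Local Notation s0 := (sphere_base R n).
Context (F : eqbundle W (prod_gspace Y Sn) -> eqbundle W' (prod_gspace Y' Sn))
  (F0 : eqbundle W Y -> eqbundle W' Y').
Hypothesis dF : forall E E1 E2, is_dsum E E1 E2 -> is_dsum (F E) (F E1) (F E2).
Hypothesis dF0 : forall E E1 E2, is_dsum E E1 E2 -> is_dsum (F0 E) (F0 E1) (F0 E2).
Hypothesis sF : forall E, slice s0 (F E) = F0 (slice s0 E).

(** The groups in each degree are kernels of restrictions to a slice, so a map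
    between them needs a functor over the product and one over the slice that
    correspond under restriction. *)
Lemma K0res_K0map x : K0res s0 (K0map F x) = K0map F0 (K0res s0 x).
Proof.
rewrite -(K0reprK x) K0map_pi // !K0res_pi K0map_pi //; congr K0pi.
elim/freeg_gen_ind: (K0repr x) => [|{}x y xE yE|E].
- rewrite free_map0 -[in LHS](subrr 0) -[in RHS](subrr 0).
  by rewrite !slice_freeB !subrr free_map0.
- by rewrite free_mapB !slice_freeB free_mapB xE yE.
- by rewrite free_mapU !slice_freeU free_mapU sF.
Qed.

Lemma Kneg_map_subproof (x : Kneg W Y n) : K0map F x \in @Kker R P' W' Y' n.
Proof.
have /eqP x0 : kneg_val x \in @Kker R P W Y n by exact: valP x.
by rewrite unfold_in /Kker K0res_K0map x0 -(subrr 0) K0mapB // subrr.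
Qed.

Definition Kneg_map (x : Kneg W Y n) : Kneg W' Y' n := MkKneg (Kneg_map_subproof x).

Fact Kneg_map_zmod_morphism : zmod_morphism Kneg_map.
Proof. by move=> x y; apply: val_inj; exact: K0mapB. Qed.
HB.instance Definition _ :=
  GRing.isZmodMorphism.Build (Kneg W Y n) (Kneg W' Y' n) Kneg_map Kneg_map_zmod_morphism.
End KnegMap.

Lemma Kneg_iso (R : realType) (P P' : tgroupType) (W : set (P * CC R))
    (W' : set (P' * CC R)) (Y : gspace P) (Y' : gspace P') (n : nat)
    (Sn := sphere R n) (s0 := sphere_base R n)
    (F : eqbundle W (prod_gspace Y Sn) -> eqbundle W' (prod_gspace Y' Sn))
    (F0 : eqbundle W Y -> eqbundle W' Y')
    (G : eqbundle W' (prod_gspace Y' Sn) -> eqbundle W (prod_gspace Y Sn))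
    (G0 : eqbundle W' Y' -> eqbundle W Y) :
  (forall E E1 E2, is_dsum E E1 E2 -> is_dsum (F E) (F E1) (F E2)) ->
  (forall E E1 E2, is_dsum E E1 E2 -> is_dsum (F0 E) (F0 E1) (F0 E2)) ->
  (forall E E1 E2, is_dsum E E1 E2 -> is_dsum (G E) (G E1) (G E2)) ->
  (forall E E1 E2, is_dsum E E1 E2 -> is_dsum (G0 E) (G0 E1) (G0 E2)) ->
  (forall E, slice s0 (F E) = F0 (slice s0 E)) ->
  (forall E, slice s0 (G E) = G0 (slice s0 E)) ->
  cancel F G -> cancel G F ->
  exists f : {additive Kneg W Y n -> Kneg W' Y' n}, bijective f.
Proof.
move=> dF dF0 dG dG0 sF sG FK GK; exists (Kneg_map dF dF0 sF).
exists (Kneg_map dG dG0 sG) => x; apply: val_inj; exact: K0mapK.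
Qed.

Lemma dprod_iso (I : Type) (M N : I -> zmodType) :
  (forall i, exists f : {additive M i -> N i}, bijective f) ->
  exists f : {additive Defs.dprod M -> Defs.dprod N}, bijective f.
Proof.
move=> iso; pose f i := sval (cid (iso i)).
have fb i : exists g, cancel (f i) g /\ cancel g (f i).
  by have [g fK gK] := svalP (cid (iso i)); exists g.
pose g i := sval (cid (fb i)).
have gP i : cancel (f i) (g i) /\ cancel (g i) (f i) := svalP (cid (fb i)).
pose h (x : Defs.dprod M) : Defs.dprod N := fun i => f i (x i).
have hB : zmod_morphism h.
  by move=> x y; apply: functional_extensionality_dep => i; exact: raddfB.
pose hA := GRing.isZmodMorphism.Build (Defs.dprod M) (Defs.dprod N) h hB.
pose ha : {additive Defs.dprod M -> Defs.dprod N} := HB.pack h hA.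
exists ha; exists (fun y i => g i (y i)) => x.
  by apply: functional_extensionality_dep => i; exact: (gP i).1.
by apply: functional_extensionality_dep => i; exact: (gP i).2.
Qed.

(** * Untwisting by a character *)

Lemma bact_vscale (R : realType) (P : tgroupType) (W : set (P * CC R))
    (Y : gspace P) (E : eqbundle W Y) p z (e : vtot E) :
  bact p (vscale z e) = vscale z (bact p e).
Proof. by rewrite /bact /tot_action /vscale /= linearZ. Qed.

Lemma u1mul_continuous (R : realType) (A : topologicalType) (f g : A -> U1 R) :
  continuous f -> continuous g -> continuous (fun x => (f x * g x)%g).
Proof.
have cv : continuous (@u1val R) by exact: initial_continuous.
move=> cf cg; apply: continuous_to_initial => x.
by apply: (@cvgM (CC R));
  [exact: (continuous_compose cf cv) | exact: (continuous_compose cg cv)].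
Qed.

Lemma disc_continuous (gT : finGroupType) (A : topologicalType) (f : disc gT -> A) :
  continuous f.
Proof.
by apply/continuousP => U _; exact: (@discrete_open (discrete_topology _)).
Qed.

Lemma Rmul_continuous (R : realType) (t : Rgrp R) : continuous (fun s => (t * s)%g).
Proof. by move=> s; apply: (@cvgD R R); [exact: cvg_cst | exact: cvg_id]. Qed.

Section Twist.
Context (R : realType) (gT : finGroupType) (g : gT) (alpha : cocycle3 R gT).
Local Notation theta := (transgression alpha g).
Local Notation T := (tcent_over g alpha).
Local Notation T0 := (cent_over g).
Local Notation KP := (Rgrp R * tcent g alpha)%type.
Local Notation KQ := (Rgrp R * cent g)%type.
Local Notation cP := (Central (@lam_gen_central R gT g T)).
Local Notation cQ := (Central (@lam_gen_central R gT g T0)).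
Context (beta : cent g -> U1 R) (chr : Rgrp R -> U1 R).
Hypothesis betaM : forall h k, (beta h * beta k = theta h k * beta (h * k))%g.
Hypothesis chrM : {morph chr : s t / (s * t)%g}.
Hypothesis chr_cont : continuous chr.
Hypothesis chr_gen : chr (-1 : R) = ((beta (cent_self g))^-1)%g.

(** A homomorphism from R * C^alpha(g) to U(1), trivial on (-1, (0, g)) and the
    identity on the central circle. *)
Definition chi (x : KP) : U1 R := (x.2.1 * (beta x.2.2 * chr x.1))%g.

(** Not a homomorphism: the defect is the cocycle, by [lift_centM], and it is
    compensated in [chiVCM] by the defect of chi along this section. *)
Definition lift_cent (x : KQ) : KP := (x.1, (1%g, x.2)).
Definition drop_circle (x : KP) : KQ := (x.1, x.2.2).
Definition circ (a : U1 R) : KP := (1%g, (a, 1%g)).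

Lemma beta1 : beta 1%g = 1%g.
Proof. by apply: (mulgI (beta 1%g)); rewrite betaM coc2_1l mulg1 mul1g mulg1. Qed.

Lemma chr1 : chr 1%g = 1%g.
Proof. by apply: (mulgI (chr 1%g)); rewrite -chrM !mulg1. Qed.

Lemma chiM x y : chi (x * y)%g = (chi x * chi y)%g.
Proof.
case: x y => [s [a h]] [t [b k]].
transitivity (a * b * theta h k * (beta (h * k) * chr (s * t)))%g; first by [].
transitivity (a * (beta h * chr s) * (b * (beta k * chr t)))%g; last by [].
have := congr1 (@u1val R) (betaM h k); rewrite chrM.
move: (theta h k) (beta (h * k)%g) => th bhk; rewrite !u1M => e.
apply: val_inj; rewrite /=.
transitivity (u1val a * u1val b * (u1val th * u1val bhk)
  * (u1val (chr s) * u1val (chr t))); first by ring.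
by rewrite -e; ring.
Qed.

Lemma chi_circ a : chi (circ a) = a.
Proof. by rewrite /chi /= beta1 chr1 !mulg1. Qed.

Lemma chi_gen : chi (lam_gen R T) = 1%g.
Proof. by rewrite /chi /= mul1g chr_gen mulgV. Qed.

Lemma chi_continuous : continuous chi.
Proof.
have c2 : continuous (fun x : KP => (x.2 : U1 R * cent g)) by exact: continuous_snd.
apply: u1mul_continuous.
  exact: (continuous_compose c2 (@continuous_fst _ _)).
apply: u1mul_continuous.
  apply: (continuous_compose (continuous_compose c2 (@continuous_snd _ _))).
  exact: disc_continuous.
exact: (continuous_compose (@continuous_fst _ _) chr_cont).
Qed.

Definition chiC (x : KP) : CC R := u1val (chi x).
Definition chiVC (x : KQ) : CC R := (u1val (chi (lift_cent x)))^-1.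

Lemma chiC_continuous : continuous chiC.
Proof.
exact: (continuous_compose chi_continuous (@initial_continuous _ _ (@u1val R))).
Qed.

Lemma lift_cent_continuous : continuous lift_cent.
Proof.
apply: continuous_pair; first exact: continuous_fst.
apply: (@continuous_pair _ (U1 R) (cent g)); first by move=> ?; exact: cvg_cst.
exact: continuous_snd.
Qed.

Lemma drop_circle_continuous : continuous drop_circle.
Proof.
apply: continuous_pair; first exact: continuous_fst.
have c2 : continuous (fun x : KP => (x.2 : U1 R * cent g)) by exact: continuous_snd.
exact: (continuous_compose c2 (@continuous_snd _ _)).
Qed.

Lemma chiVC_continuous : continuous chiVC.
Proof.
move=> x; apply: cvgV; first exact: u1_neq0.
exact: (continuous_compose lift_cent_continuous chiC_continuous).
Qed.

Lemma KQ_trans (x : KQ) : continuous (fun y => (x * y)%g).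
Proof.
case: x => t h; apply: (@continuous_pair _ (Rgrp R) (cent g)
  (fun y => (t * y.1)%g) (fun y => (h * y.2)%g)).
  exact: (continuous_compose (@continuous_fst _ _) (@Rmul_continuous R t)).
exact: (continuous_compose (@continuous_snd _ _) (@disc_continuous _ _ _)).
Qed.

Lemma KP_trans (x : KP) : continuous (fun y => (x * y)%g).
Proof.
case: x => t [a h].
have c2 : continuous (fun x : KP => (x.2 : U1 R * cent g)) by exact: continuous_snd.
have c21 := continuous_compose c2 (@continuous_fst _ _).
have c22 := continuous_compose c2 (@continuous_snd _ _).
have d1 : continuous (fun y : KP => (t * y.1)%g : Rgrp R).
  exact: (continuous_compose (@continuous_fst _ _) (@Rmul_continuous R t)).
have d2 : continuous (fun y : KP => (a * y.2.1 * theta h y.2.2)%g).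
  apply: u1mul_continuous.
    by apply: u1mul_continuous c21 => ?; exact: cvg_cst.
  exact: (continuous_compose c22 (@disc_continuous _ _ _)).
have d3 : continuous (fun y : KP => (h * y.2.2)%g : cent g).
  exact: (continuous_compose c22 (@disc_continuous _ _ _)).
exact: (continuous_pair d1 (continuous_pair d2 d3)).
Qed.

Lemma lift_centM x y :
  (lift_cent x * lift_cent y = circ (theta x.2 y.2) * lift_cent (x * y))%g.
Proof.
case: x y => [s h] [t k].
change ((s * t, (1 * 1 * theta h k, h * k)) =
  (1 * (s * t), (theta h k * 1 * theta 1 (h * k), 1 * (h * k))) :> KP)%g.
by rewrite coc2_1l !mul1g !mulg1.
Qed.

Lemma chiVCM x y : chiVC (x * y)%g = chiVC x * chiVC y * u1val (theta x.2 y.2).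
Proof.
have : (theta x.2 y.2 * chi (lift_cent (x * y)) =
    chi (lift_cent x) * chi (lift_cent y))%g.
  by rewrite -chiM lift_centM chiM chi_circ.
rewrite /chiVC; move: (theta _ _) (chi _) (chi _) (chi _) => t c a b.
move/(congr1 (@u1val R)); rewrite !u1M => e.
by rewrite -invfM -e invfM [RHS]mulrC (mulVKf (u1_neq0 t)).
Qed.

Lemma circ_drop (x : KP) : (circ x.2.1 * lift_cent (drop_circle x))%g = x.
Proof.
case: x => t [a h].
change ((1 * t, (a * 1 * theta 1 h, 1 * h)) = (t, (a, h)) :> KP)%g.
by rewrite coc2_1l !mul1g !mulg1.
Qed.

Lemma chiC_drop x : chiC x * chiVC (drop_circle x) = u1val x.2.1.
Proof.
have : chi x = (x.2.1 * chi (lift_cent (drop_circle x)))%g.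
  by rewrite -{1}(circ_drop x) chiM chi_circ.
rewrite /chiC /chiVC; move: (chi _) (chi _) => a b ->.
by rewrite u1M mulfK // u1_neq0.
Qed.

Lemma circ_graph a : circle_graph g alpha (cproj cP (circ a), u1val a).
Proof. by exists a. Qed.

Lemma cproj_gen (P : tgroupType) (c : central P) : cproj c (celt c) = 1%g.
Proof.
rewrite -cproj1; apply/cprojP; exists 1%N; right; rewrite mulg1 expg1 //.
Qed.

(** The defect of the section acts on a twisted bundle by a scalar, because the
    central circle does; [chiVCM] cancels it. *)
Lemma untwist_rescalable (X : gspace (Lambda R T))
    (E : eqbundle (circle_graph g alpha) X) :
  @rescalable R KP KQ cP cQ (circle_graph g alpha) set0 lift_cent chiVC X E.
Proof.
split=> //.
- move=> e; rewrite /rescaled.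
  rewrite [lift_cent _](_ : _ = 1%g) // cproj1 bact1 /chiVC.
  rewrite [lift_cent _](_ : _ = 1%g) // (_ : chi _ = 1%g) ?invr1 ?vscale1 //.
  exact: chi_circ.
- move=> x y e; rewrite /rescaled bact_vscale -vscaleM -bactM -cprojM lift_centM.
  rewrite cprojM bactM; move: (bact (cproj cP (lift_cent (x * y)%g)) e) => f.
  have -> : bact (cproj cP (circ (theta x.2 y.2))) f = vscale (u1val (theta x.2 y.2)) f.
    by case: f => z v; exact: (bactW (circ_graph _)).
  by rewrite -vscaleM chiVCM.
- move=> e; rewrite /rescaled /chiVC.
  rewrite [lift_cent _](_ : _ = lam_gen R T) // chi_gen invr1 vscale1.
  by rewrite (cproj_gen cP) bact1.
Qed.

Lemma twist_rescalable (X : gspace (Lambda R T0))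
    (E : eqbundle (set0 : set (Lambda R T0 * CC R)) X) :
  @rescalable R KQ KP cQ cP set0 (circle_graph g alpha) drop_circle chiC X E.
Proof.
split=> //.
- move=> e; rewrite /rescaled.
  rewrite [drop_circle _](_ : _ = 1%g) // cproj1 bact1 /chiC.
  rewrite (_ : chi _ = 1%g) ?vscale1 //; exact: chi_circ.
- move=> x y e; rewrite /rescaled bact_vscale -vscaleM -bactM -cprojM.
  by rewrite /chiC chiM.
- move=> e; rewrite /rescaled /chiC.
  rewrite [drop_circle _](_ : _ = lam_gen R T0) // [chi _]chi_gen vscale1.
  by rewrite (cproj_gen cQ) bact1.
- move=> p z [a _ [<- <-]]; exists (circ a) => // e.
  rewrite /rescaled /chiC chi_circ; congr vscale.
  by rewrite [drop_circle _](_ : _ = 1%g) // cproj1 bact1.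
Qed.

Section OneSpace.
Context (Y : topologicalType) (aP : Lambda R T -> Y -> Y) (aQ : Lambda R T0 -> Y -> Y).
Context (aP1 : forall x, aP 1%g x = x)
  (aPM : forall p q x, aP (p * q)%g x = aP p (aP q x))
  (aPc : continuous (fun px : Lambda R T * Y => aP px.1 px.2)).
Context (aQ1 : forall x, aQ 1%g x = x)
  (aQM : forall p q x, aQ (p * q)%g x = aQ p (aQ q x))
  (aQc : continuous (fun px : Lambda R T0 * Y => aQ px.1 px.2)).
Local Notation XP := (GSpace aP1 aPM aPc).
Local Notation XQ := (GSpace aQ1 aQM aQc).
Hypothesis compatP : forall x y, aP (cproj cP x) y = aQ (cproj cQ (drop_circle x)) y.
Hypothesis compatQ : forall x y, aQ (cproj cQ x) y = aP (cproj cP (lift_cent x)) y.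

Definition untwist (E : eqbundle (circle_graph g alpha) XP) :
    eqbundle (set0 : set (Lambda R T0 * CC R)) XQ :=
  rescale KQ_trans lift_cent_continuous chiVC_continuous aQ1 aQM aQc compatQ
    (untwist_rescalable E).

Definition twist (E : eqbundle (set0 : set (Lambda R T0 * CC R)) XQ) :
    eqbundle (circle_graph g alpha) XP :=
  rescale KP_trans drop_circle_continuous chiC_continuous aP1 aPM aPc compatP
    (twist_rescalable E).

Lemma untwist_dsum E E1 E2 :
  is_dsum E E1 E2 -> is_dsum (untwist E) (untwist E1) (untwist E2).
Proof. exact: rescale_dsum. Qed.

Lemma twist_dsum E E1 E2 :
  is_dsum E E1 E2 -> is_dsum (twist E) (twist E1) (twist E2).
Proof. exact: rescale_dsum. Qed.

Lemma untwistK : cancel untwist twist.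
Proof.
move=> E; apply: rescaleK => x e; rewrite -vscaleM.
rewrite -[in RHS](circ_drop x) cprojM bactM.
move: (bact (cproj cP (lift_cent (drop_circle x))) e) => f.
have -> : bact (cproj cP (circ x.2.1)) f = vscale (u1val x.2.1) f.
  by case: f => z v; exact: (bactW (circ_graph _)).
by rewrite chiC_drop.
Qed.

Lemma twistK : cancel twist untwist.
Proof.
move=> E; apply: rescaleK => x e; rewrite -vscaleM.
rewrite /chiC /chiVC mulVf ?u1_neq0 // vscale1.
by case: x.
Qed.
End OneSpace.

Lemma twisted_Kdeg_iso (Y : topologicalType)
    (aP : Lambda R T -> Y -> Y) (aQ : Lambda R T0 -> Y -> Y)
    (aP1 : forall x, aP 1%g x = x)
    (aPM : forall p q x, aP (p * q)%g x = aP p (aP q x))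
    (aPc : continuous (fun px : Lambda R T * Y => aP px.1 px.2))
    (aQ1 : forall x, aQ 1%g x = x)
    (aQM : forall p q x, aQ (p * q)%g x = aQ p (aQ q x))
    (aQc : continuous (fun px : Lambda R T0 * Y => aQ px.1 px.2)) (n : int) :
  (forall x y, aP (cproj cP x) y = aQ (cproj cQ (drop_circle x)) y) ->
  exists f : {additive Kdeg (circle_graph g alpha) (GSpace aP1 aPM aPc) n ->
    Kdeg (set0 : set (Lambda R T0 * CC R)) (GSpace aQ1 aQM aQc) n}, bijective f.
Proof.
move=> compatP.
have compatQ x y : aQ (cproj cQ x) y = aP (cproj cP (lift_cent x)) y.
  by rewrite compatP; case: x.
set XP := GSpace aP1 aPM aPc; set XQ := GSpace aQ1 aQM aQc.
pose Sn := sphere R `|n|%N; pose s0 := sphere_base R `|n|%N.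
pose XPS := prod_gspace XP Sn; pose XQS := prod_gspace XQ Sn.
pose cPS := compat_prod aQ1 aQM aQc aP1 aPM aPc compatP (S := Sn).
pose cQS := compat_prod aP1 aPM aPc aQ1 aQM aQc compatQ (S := Sn).
pose F : eqbundle (circle_graph g alpha) XPS -> eqbundle set0 XQS :=
  @untwist _ _ _ (@Defs.gact1 _ XPS) (@Defs.gactM _ XPS) (@Defs.gact_cont _ XPS)
    (@Defs.gact1 _ XQS) (@Defs.gactM _ XQS) (@Defs.gact_cont _ XQS) cQS.
pose G : eqbundle set0 XQS -> eqbundle (circle_graph g alpha) XPS :=
  @twist _ _ _ (@Defs.gact1 _ XPS) (@Defs.gactM _ XPS) (@Defs.gact_cont _ XPS)
    (@Defs.gact1 _ XQS) (@Defs.gactM _ XQS) (@Defs.gact_cont _ XQS) cPS.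
apply: (@Kneg_iso _ _ _ _ _ _ _ _ F (@untwist _ _ _ aP1 aPM aPc aQ1 aQM aQc compatQ)
  G (@twist _ _ _ aP1 aPM aPc aQ1 aQM aQc compatP)).
- exact: untwist_dsum.
- exact: untwist_dsum.
- exact: twist_dsum.
- exact: twist_dsum.
- move=> E.
  exact: (slice_rescale KQ_trans lift_cent_continuous chiVC_continuous aQ1 aQM aQc
     compatQ (untwist_rescalable E) (untwist_rescalable (slice s0 E))).
- move=> E.
  exact: (slice_rescale KP_trans drop_circle_continuous chiC_continuous aP1 aPM aPc
     compatP (twist_rescalable E) (twist_rescalable (slice s0 E))).
- exact: untwistK.
- exact: twistK.
Qed.
End Twist.

(** Both groups act on the fixed points through the centraliser of g. *)
Lemma fix_gspace_drop (R : realType) (gT : finGroupType) (g : gT)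
    (alpha : cocycle3 R gT) (X : gspace (disc gT)) x (y : @fixpts gT g X) :
  lam_act (cproj (Central (@lam_gen_central R gT g (tcent_over g alpha))) x) y =
  lam_act (cproj (Central (@lam_gen_central R gT g (cent_over g))) (drop_circle x)) y.
Proof. by apply: val_inj; rewrite /= !lam_pr_fix //; exact: set_valP. Qed.

Lemma QEll_component_iso (R : realType) (G : finsubg (uquat R))
    (alpha : cocycle3 R (fsgT G)) (X : gspace (disc (fsgT G))) (g : fsgT G) (n : int) :
  exists f : {additive
    Kdeg (circle_graph g alpha) (fix_gspace R (tcent_over g alpha) X) n ->
    Kdeg (set0 : set (Lambda R (cent_over g) * CC R)) (fix_gspace R (cent_over g) X) n},
  bijective f.
Proof.
have [||beta betaM] := @coboundary_uquat R _ (transgression alpha g)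
  (fun h => fsval (cent_val h)).
- by move=> h k e; apply: cent_val_inj; apply: val_inj; exact: e.
- by [].
have [chr [chr_cont chrM chr_gen]] := Rchar_exists ((beta (cent_self g))^-1)%g.
apply: (twisted_Kdeg_iso betaM chrM chr_cont chr_gen) => x y.
exact: fix_gspace_drop.
Qed.

(* so that [set: _] denotes a finite set, as in [is_transversal] *)
Local Close Scope ring_scope.
Local Close Scope classical_set_scope.

Theorem corollary6p9 (R : realType) (G : finsubg (uquat R))
    (alpha : cocycle3 R (fsgT G)) (reps : {set fsgT G})
    (hreps : is_transversal reps (classes [set: fsgT G]) [set: fsgT G]) :
  forall n : int,
    exists f : {additive QEll_tw (S4 G) reps n alpha -> QEll R (S4 G) reps n},
      bijective f.
Proof.
by move=> n; apply: dprod_iso => -[g gr]; exact: QEll_component_iso.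
Qed.
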